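(* Let $z_1,\dots,z_n$ be distinct points in the open unit disk $\mathbb{D}$, let $w_1,\dots,w_n$ be complex numbers, and let $A>0$. Then there exists an analytic function $f$ on $\mathbb{D}$ with $\|f\|_\infty\le A$ and $f'(0)=0$ such that $f(z_i)=w_i$ for $i=1,\dots,n$ if and only if the $n\times n$ matrix \[ \Big[(A^2-w_i\overline{w_j})\,K^{\alpha,\beta}(z_i,z_j)\Big]_{i,j=1}^n \] is positive semidefinite for all $(\alpha,\beta)\in\mathbb{C}^2$ with $|\alpha|^2+|\beta|^2=1$.
   Context: $\|f\|_\infty=\sup\{|f(z)|:z\in\mathbb{D}\}$. For $(\alpha,\beta)\in\mathbb{C}^2$ with $|\alpha|^2+|\beta|^2=1$ and $z,w\in\mathbb{D}$, \[ K^{\alpha,\beta}(z,w)=(\alpha+\beta z)\overline{(\alpha+\beta w)}+\frac{z^2\overline{w}^2}{1-z\overline{w}}. \] *)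

(* Defs.v *)
From HB Require Import structures.
From mathcomp Require Export all_boot all_order all_algebra.
From mathcomp Require Export complex.
From mathcomp Require Export all_classical all_reals all_analysis.

Set Implicit Arguments.
Unset Strict Implicit.
Unset Printing Implicit Defensive.

Import Order.TTheory GRing.Theory Num.Theory.
Export numFieldNormedType.Exports.

Local Open Scope complex_scope.
Local Open Scope ring_scope.
Local Open Scope classical_set_scope.

(* The topology and the normed-module structure of a field of scalars are
   declared in the library on the projections of abstract numeric fields, not
   on the concrete type [R[i]]; packing [R[i]] makes them available. *)
Definition Cplx (R : realType) : numClosedFieldType := R[i].

Definition unit_disk (K : numDomainType) : set K := [set z | `|z| < 1].
Arguments unit_disk : clear implicits.

(* Near each point of [U], [f] is the sum of a convergent power series centred
   there.  Values of [f] away from [U] are irrelevant when [U] is open. *)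
Definition analytic_on (K : numFieldType) (U : set K) (f : K -> K) : Prop :=
  forall c, U c -> exists a : nat -> K,
    \forall z \near c, series (fun k => a k * (z - c) ^+ k) @ \oo --> f z.

(* Extended-real valued, so that unbounded functions have norm [+oo]. *)
Definition Hinfty_norm (R : realType) (f : Cplx R -> Cplx R) : \bar R :=
  ereal_sup [set (Normc.normc (f z))%:E | z in unit_disk (Cplx R)].

(* Over a [numClosedFieldType], [0 <= x] entails that [x] is real, so
   [M] is in particular Hermitian. *)
Definition psdmx (C : numClosedFieldType) (n : nat) (M : 'M[C]_n) : Prop :=
  forall v : 'cV[C]_n, 0 <= ((map_mx Num.conj v)^T *m M *m v) 0 0.

Definition Kab (C : numClosedFieldType) (alpha beta z w : C) : C :=
  (alpha + beta * z) * (alpha + beta * w)^* +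
  z ^+ 2 * w^* ^+ 2 / (1 - z * w^*).

(* Main.v *)
From mathcomp Require Import finmap.
Require Import Defs.
From mathcomp Require Import ring lra.

(** Normalise [A = 1].

Necessity: after composing with a disk automorphism, [f] becomes [F = z^2 G]
with [G] in the unit ball, and with [k] the Szego kernel, [e = alpha + beta z]
and [e' = - beta^* + alpha^* z],
[(1 - F F^* ) K^{alpha,beta} = e e^* + z^2 ((1 - G G^* ) k + G e' (G e')^* ) (z^2)^*],
so everything follows from the necessity of the classical Pick condition for
[G].  That is proved by the Schur algorithm, which only needs the Schwarz lemma;
the maximum principle holds because [|G|^2 + eta |z|^2] has no interior local
maximum, by averaging a second order expansion over [t, it, -t, -it].

Sufficiency: a solution with value [t] at [0] exists as soon as a Hermitian
form [- dform t], quadratic in [t], is positive semidefinite.  For each vector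
[v] the hypothesis over all [(alpha, beta)] says, through a 2x2 determinant,
that the disk [{t | dform t v <= 0}] is nonempty.  These disks have a common
point: otherwise finitely many of them do not meet, the minimiser of the sum of
the squared positive parts of their [dform]s gives a mixture of vectors at which
the derivative in [t] vanishes while [dform > 0], and the Toeplitz-Hausdorff
rotation replaces the mixture by one vector, whose disk is then empty.  With [t]
at hand the Schur algorithm produces a rational solution. *)

Set Implicit Arguments.
Unset Strict Implicit.
Unset Printing Implicit Defensive.

Import Order.TTheory GRing.Theory Num.Theory.

Local Open Scope complex_scope.
Local Open Scope ring_scope.
Local Open Scope classical_set_scope.

(** * Positive semidefinite kernels and the Pick problem for rational functions *)

Section Kernels.
Variables (C : numClosedFieldType) (I : eqType).
Implicit Types (s : seq I) (K L : I -> I -> C) (u v x : I -> C).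

(** Conjugate-linear in [u]. Indexing by a list makes it possible to add or remove one node at a
    time, as the Schur algorithm does. *)
Definition hform s K u v : C := \sum_(i <- s) \sum_(j <- s) (u i)^* * K i j * v j.

Definition kpsd s K := forall v, 0 <= hform s K v v.

Lemma eq_hform s K L u v u' v' :
  (forall i, i \in s -> u i = u' i) -> (forall i, i \in s -> v i = v' i) ->
  (forall i j, i \in s -> j \in s -> K i j = L i j) ->
  hform s K u v = hform s L u' v'.
Proof.
move=> eu ev eK; apply: eq_big_seq => i si; apply: eq_big_seq => j sj.
by rewrite eu // ev // eK.
Qed.

Lemma eq_kpsd s K L :
  (forall i j, i \in s -> j \in s -> K i j = L i j) -> kpsd s K -> kpsd s L.
Proof. by move=> eK Kp v; rewrite -(eq_hform (K := K) (u := v) (v := v)). Qed.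

Lemma hformD s K L u v :
  hform s (fun i j => K i j + L i j) u v = hform s K u v + hform s L u v.
Proof.
rewrite -big_split; apply: eq_bigr => i _; rewrite -big_split.
by apply: eq_bigr => j _; rewrite mulrDr mulrDl.
Qed.

Lemma hformZ s (c : C) K u v : hform s (fun i j => c * K i j) u v = c * hform s K u v.
Proof.
rewrite mulr_sumr; apply: eq_bigr => i _; rewrite mulr_sumr.
by apply: eq_bigr => j _; ring.
Qed.

Lemma hform_congr s x K u v :
  hform s (fun i j => x i * K i j * (x j)^*) u v =
  hform s K (fun i => (x i)^* * u i) (fun i => (x i)^* * v i).
Proof.
apply: eq_bigr => i _; apply: eq_bigr => j _.
by rewrite rmorphM /= conjCK; ring.
Qed.

Lemma hform_rank1 s x y u v :
  hform s (fun i j => x i * (y j)^*) u v =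
  (\sum_(i <- s) (u i)^* * x i) * (\sum_(i <- s) (v i)^* * y i)^*.
Proof.
rewrite rmorph_sum /= big_distrlr /=; apply: eq_bigr => i _.
by apply: eq_bigr => j _; rewrite rmorphM /= conjCK; ring.
Qed.

Lemma kpsdD s K L : kpsd s K -> kpsd s L -> kpsd s (fun i j => K i j + L i j).
Proof. by move=> Kp Lp v; rewrite hformD addr_ge0. Qed.

Lemma kpsdZ s (c : C) K : 0 <= c -> kpsd s K -> kpsd s (fun i j => c * K i j).
Proof. by move=> c0 Kp v; rewrite hformZ mulr_ge0. Qed.

Lemma kpsd_congr s x K : kpsd s K -> kpsd s (fun i j => x i * K i j * (x j)^*).
Proof. by move=> Kp v; rewrite hform_congr. Qed.

Lemma kpsd_rank1 s x : kpsd s (fun i j => x i * (x j)^*).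
Proof. by move=> v; rewrite hform_rank1 mul_conjC_ge0. Qed.

Lemma hform_cons0 s i0 K u v :
  (forall i, K i i0 = 0) -> (forall i, K i0 i = 0) ->
  hform (i0 :: s) K u v = hform s K u v.
Proof.
move=> K1 K2; rewrite /hform big_cons big1 ?add0r.
  by apply: eq_bigr => i _; rewrite big_cons K1 mulr0 mul0r add0r.
by move=> j _; rewrite K2 mulr0 mul0r.
Qed.

Lemma kpsd_filter s (P : pred I) K : kpsd s K -> kpsd [seq i <- s | P i] K.
Proof.
move=> Kp v; have := Kp (fun i => if P i then v i else 0).
congr (_ <= _); rewrite /hform [RHS]big_filter [RHS]big_mkcond.
apply: eq_bigr => i _; case: ifP => _; last first.
  by rewrite big1 // => j _; rewrite conjC0 !mul0r.
rewrite [RHS]big_filter [RHS]big_mkcond; apply: eq_bigr => j _.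
by case: ifP => _ //; rewrite mulr0.
Qed.

Lemma kpsd_sub s t K :
  uniq s -> uniq t -> {subset t <= s} -> kpsd s K -> kpsd t K.
Proof.
move=> us ut ts /(kpsd_filter (mem t)) Kp v; have := Kp v.
have pt : perm_eq [seq x <- s | mem t x] t.
  apply: uniq_perm; rewrite ?filter_uniq // => x; rewrite mem_filter /=.
  by apply/andP/idP => [[]|xt] //; split=> //; exact: ts.
congr (_ <= _); rewrite /hform (perm_big _ pt); apply: eq_bigr => i _.
exact: perm_big.
Qed.

Lemma kpsd_diag s K i : uniq s -> kpsd s K -> i \in s -> 0 <= K i i.
Proof.
move=> us Kp si; have si' : {subset [:: i] <= s} by move=> j; rewrite inE => /eqP ->.
have := kpsd_sub us (isT : uniq [:: i]) si' Kp (fun=> 1).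
by rewrite /hform !big_seq1 conjC1 mul1r mulr1.
Qed.

(** The vector with entries [1 + K j j] at [i] and [- conj(K i j)] at [j] gives the form the value
    [- |K i j|^2 (2 + K j j)], which is nonnegative only if [K i j = 0]. *)
Lemma kpsd_diag0 s K i j : uniq s -> kpsd s K -> i \in s -> j \in s ->
  K j i = (K i j)^* -> K i i = 0 -> K i j = 0.
Proof.
move=> us Kp si sj Kij Kii; have [->//|ij] := eqVneq j i.
have sij : {subset [:: i; j] <= s}.
  by move=> k; rewrite !inE => /orP[] /eqP ->.
have uij : uniq [:: i; j] by rewrite /= inE eq_sym ij.
have Kj := kpsd_diag us Kp sj.
pose t := 1 + K j j.
have tt : t^* = t by apply: conj_Creal; apply: ger0_real; rewrite addr_ge0.
have := kpsd_sub us uij sij Kp (fun k => if k == j then - (K i j)^* else t).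
rewrite /hform !big_cons !big_nil !addr0 eqxx (eq_sym i) (negPf ij) Kii Kij tt.
rewrite rmorphN /= conjCK.
have -> : t * 0 * t + t * K i j * - (K i j)^* + (- K i j * (K i j)^* * t + - K i j * K j j * - (K i j)^*)
   = - (K i j * (K i j)^* * (t + 1)) by rewrite /t; ring.
rewrite oppr_ge0 pmulr_lle0; last by rewrite addr_gt0 ?ltr01 ?(lt_le_trans ltr01) ?lerDl.
move=> mle; have /eqP : K i j * (K i j)^* == 0 by rewrite eq_le mle mul_conjC_ge0.
by move/eqP; rewrite mul_conjC_eq0 => /eqP.
Qed.

End Kernels.

(** * Mobius maps and Blaschke factors of the unit disk *)

Section Disk.
Variable C : numClosedFieldType.
Implicit Types a c x y p q : C.

Lemma disk_sub_neq0 x y : `|x| < 1 -> `|y| <= 1 -> 1 - x * y != 0.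
Proof.
move=> x1 y1; rewrite subr_eq0; apply/eqP => e.
suff : `|x * y| < 1 by rewrite -e normr1 ltxx.
by rewrite normrM; apply: le_lt_trans x1; rewrite ler_piMr.
Qed.

(** The difference of the squares is [(|q|^2 - |p|^2) (1 - |c|^2)]. Numerator and denominator are
    kept apart so that it applies to values of polynomials without any division. *)
Lemma mobius_norm c p q :
  `|c| <= 1 -> `|p| <= `|q| -> `|p + c * q| <= `|q + c^* * p|.
Proof.
move=> c1 pq; rewrite -(ler_pXn2r (ltn0Sn 1)) ?nnegrE ?normr_ge0 //.
rewrite -subr_ge0.
have -> : `|q + c^* * p| ^+ 2 - `|p + c * q| ^+ 2 =
  (`|q| ^+ 2 - `|p| ^+ 2) * (1 - `|c| ^+ 2).
  by rewrite !normCK !rmorphD /= !rmorphM /= conjCK; ring.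
by rewrite mulr_ge0 // subr_ge0 ?lerXn2r ?nnegrE ?expr_le1.
Qed.

Lemma blaschke_norm a x : `|a| < 1 -> `|x| <= 1 -> `|x - a| <= `|1 - a^* * x|.
Proof.
move=> a1 x1; have := @mobius_norm (- a) x 1.
by rewrite normrN normr1 rmorphN /= mulr1 mulNr => -> //; exact: ltW.
Qed.

Lemma blaschke_norm_lt a x : `|a| < 1 -> `|x| < 1 -> `|x - a| < `|1 - a^* * x|.
Proof.
move=> a1 x1; rewrite -(ltr_pXn2r (ltn0Sn 1)) ?nnegrE ?normr_ge0 //.
rewrite -subr_gt0.
have -> : `|1 - a^* * x| ^+ 2 - `|x - a| ^+ 2 = (1 - `|x| ^+ 2) * (1 - `|a| ^+ 2).
  by rewrite !normCK !rmorphB /= rmorphM /= conjCK conjC1; ring.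
by rewrite mulr_gt0 // subr_gt0 expr_lt1.
Qed.

End Disk.

(** * The Schur algorithm for the classical Pick problem *)

Section Pick.
Variables (C : numClosedFieldType) (I : eqType).
Implicit Types (s : seq I) (z w G : I -> C).

Definition pick_kernel z w (i j : I) : C := (1 - w i * (w j)^*) / (1 - z i * (z j)^*).

(** The Blaschke factor vanishing at the node [z i0]. *)
Let bl z i0 i : C := (z i - z i0) / (1 - (z i0)^* * z i).

(** This is the Pick kernel of the product [bl * G], split into the Pick kernel of [bl], which has
    rank one, and a congruent copy of the Pick kernel of [G]. *)
Let red z i0 G i j : C :=
  (1 - `|z i0| ^+ 2) * ((1 - (z i0)^* * z i)^-1 * ((1 - (z i0)^* * z j)^-1)^*)
  + bl z i0 i * pick_kernel z G i j * (bl z i0 j)^*.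

(** The Mobius map [x -> (x + c) / (1 + conj(c) x)] multiplies [1 - x conj(y)] by [1 - |c|^2] and
    divides it by the two denominators, so the Pick kernels before and after are congruent up to a
    scalar. *)
Lemma pick_kernel_schur z G (c : C) i0 i j :
  (forall k, `|z k| < 1) ->
  1 + c^* * (bl z i0 i * G i) != 0 -> 1 + c^* * (bl z i0 j * G j) != 0 ->
  let u k := (bl z i0 k * G k + c) / (1 + c^* * (bl z i0 k * G k)) in
  pick_kernel z u i j =
   (1 - `|c| ^+ 2) *
   ((1 + c^* * (bl z i0 i * G i))^-1 * red z i0 G i j *
    ((1 + c^* * (bl z i0 j * G j))^-1)^*).
Proof.
move=> zD n1 n2 u.
have n1' : 1 + c * ((bl z i0 i)^* * (G i)^*) != 0.
  by have := n1; rewrite -conjC_eq0 !(rmorphD, rmorphM) /= conjCK conjC1.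
have n2' : 1 + c * ((bl z i0 j)^* * (G j)^*) != 0.
  by have := n2; rewrite -conjC_eq0 !(rmorphD, rmorphM) /= conjCK conjC1.
have d k l : 1 - z k * (z l)^* != 0.
  by rewrite disk_sub_neq0 // norm_conjC ltW.
have d' k : 1 - z i0 * (z k)^* != 0 := d i0 k.
have d2 k : 1 - (z i0)^* * z k != 0 by rewrite mulrC.
pose B k := bl z i0 k; rewrite -/(B i) -/(B j) in n1 n2 n1' n2' *.
have eB : (1 - B i * (B j)^*) / (1 - z i * (z j)^*) =
   (1 - `|z i0| ^+ 2) * ((1 - (z i0)^* * z i)^-1 * ((1 - (z i0)^* * z j)^-1)^*).
  rewrite /B /bl normCK !(rmorphM, rmorphB, fmorphV) /= !conjCK !conjC1.
  by field; apply/and3P; split; [exact: d'|exact: d2|exact: d].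
rewrite /red -/(B i) -/(B j) -eB /pick_kernel /u -/(B i) -/(B j) normCK.
move: (B i) (B j) n1 n2 n1' n2' => bi bj n1 n2 n1' n2'.
rewrite !(rmorphM, rmorphB, rmorphD, fmorphV) /= !(rmorphM, rmorphB, rmorphD, fmorphV, conjCK, conjC1) /=.
by field; apply/and3P; split; [exact: n2'|exact: d|exact: n1].
Qed.

(** Since [bl] vanishes at [i0], the new node does not contribute to the copy of the kernel of [G]
    in [red], and the other summand has rank one. *)
Lemma kpsd_pick_up s z G (c : C) i0 :
  (forall k, `|z k| < 1) -> `|c| < 1 -> (forall k, `|G k| <= 1) ->
  kpsd s (pick_kernel z G) ->
  kpsd (i0 :: s) (pick_kernel z (fun k =>
    (bl z i0 k * G k + c) / (1 + c^* * (bl z i0 k * G k)))).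
Proof.
move=> zD c1 G1 Gp.
have b1 k : `|bl z i0 k| <= 1.
  rewrite normrM normfV ler_pdivrMr ?mul1r ?blaschke_norm ?ltW //.
  by rewrite normr_gt0 disk_sub_neq0 // ?norm_conjC // ltW.
have n k : 1 + c^* * (bl z i0 k * G k) != 0.
  rewrite -[_ * (_ * _)]opprK -mulrN disk_sub_neq0 ?norm_conjC // normrN normrM.
  by rewrite mulr_ile1.
apply: (@eq_kpsd _ _ _ (fun i j =>
   (1 - `|c| ^+ 2) *
   ((1 + c^* * (bl z i0 i * G i))^-1 * red z i0 G i j *
    ((1 + c^* * (bl z i0 j * G j))^-1)^*))).
  by move=> i j _ _; rewrite (@pick_kernel_schur _ _ c i0 i j).
apply: kpsdZ; first by rewrite subr_ge0 expr_le1 // ltW.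
apply: kpsd_congr; apply: kpsdD.
  apply: kpsdZ; first by rewrite subr_ge0 expr_le1 // ltW.
  exact: kpsd_rank1.
move=> v; rewrite hform_cons0; first exact: kpsd_congr.
  by move=> i; rewrite /bl subrr mul0r conjC0 mulr0.
by move=> i; rewrite /bl subrr !mul0r.
Qed.

(** A Schur complement argument: a test vector on [s] is extended to [i0] so that the rank one
    summand of [red] vanishes on it. *)
Lemma kpsd_pick_down s z G (c : C) i0 :
  (forall k, `|z k| < 1) -> `|c| < 1 ->
  (forall k, k \in s -> z k != z i0) ->
  (forall k, k \in i0 :: s -> 1 + c^* * (bl z i0 k * G k) != 0) ->
  kpsd (i0 :: s) (pick_kernel z (fun k =>
    (bl z i0 k * G k + c) / (1 + c^* * (bl z i0 k * G k)))) ->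
  kpsd s (pick_kernel z G).
Proof.
move=> zD c1 zi n up.
have c2 : 1 - `|c| ^+ 2 != 0 by rewrite subr_eq0 eq_sym lt_eqF // expr_lt1.
have d k : 1 - (z i0)^* * z k != 0 by rewrite disk_sub_neq0 ?norm_conjC ?ltW.
have redp : kpsd (i0 :: s) (red z i0 G).
  have := kpsd_congr (fun k => 1 + c^* * (bl z i0 k * G k)) up.
  move/(@kpsdZ _ _ _ (1 - `|c| ^+ 2)^-1).
  rewrite invr_ge0 subr_ge0 expr_le1 // ltW // => /(_ isT).
  apply: eq_kpsd => i j si sj; rewrite (@pick_kernel_schur _ _ c i0 i j) ?n //.
  move: (n i si) (n j sj); move: (1 + _ * (bl z i0 i * _)) => x.
  move: (1 + _ * (bl z i0 j * _)) => y x0 y0.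
  by rewrite fmorphV /=; field; rewrite c2 x0 fmorph_eq0 y0.
move=> v'.
have i0s : i0 \notin s by apply/negP => /zi; rewrite eqxx.
pose r k := (1 - (z i0)^* * z k)^-1.
have r0 k : r k != 0 by rewrite invr_eq0.
(* Dividing by the Blaschke factor undoes the congruence; the entry at [i0] then makes [v]
   orthogonal to [r]. *)
pose v0 k := v' k / (bl z i0 k)^*.
pose v k := if k == i0 then - (\sum_(i <- s) v0 i * (r i)^*) / (r i0)^* else v0 k.
have vE k : k \in s -> v k = v0 k.
  by move=> sk; rewrite /v; case: eqP => // ke; rewrite -ke sk in i0s.
have := redp v; rewrite /red hformD hformZ hform_rank1.
have -> : \sum_(i <- i0 :: s) (v i)^* * r i = 0.
  apply: (can_inj (@conjCK C)); rewrite rmorph_sum conjC0 big_cons.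
  rewrite rmorphM /= conjCK /v eqxx mulfVK ?fmorph_eq0 //.
  apply/eqP; rewrite addrC subr_eq0; apply/eqP; apply: eq_big_seq => k sk.
  by rewrite rmorphM /= conjCK -/(v k) vE.
rewrite mul0r mulr0 add0r hform_cons0; last 2 first.
- by move=> i; rewrite /bl subrr mul0r conjC0 mulr0.
- by move=> i; rewrite /bl subrr !mul0r.
rewrite hform_congr (@eq_hform _ _ _ _ (pick_kernel z G) _ _ v' v') // => k sk;
  by rewrite vE // /v0 mulrC mulfVK // conjC_eq0 mulf_neq0 ?invr_eq0 ?d ?subr_eq0 ?zi.
Qed.

Definition rat_schur (p q : {poly C}) :=
  forall x : C, `|x| < 1 -> q.[x] != 0 /\ `|p.[x]| <= `|q.[x]|.

(** Induction on the nodes: a Mobius map sends the value at the first node to 0, and dividing by the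
    Blaschke factor of that node leaves a Pick problem on the remaining ones. *)
Lemma pick_rational s z w :
  (forall k, `|z k| < 1) -> uniq (map z s) -> kpsd s (pick_kernel z w) ->
  exists p q, rat_schur p q /\ forall i, i \in s -> p.[z i] = w i * q.[z i].
Proof.
move=> zD; elim: s w => [|i0 s IH] w /=.
  move=> _ _; exists 0, 1; split => // x _.
  by rewrite !hornerE oner_neq0 normr0 normr1 ler01.
move=> /andP[zi0 us] wp.
have us' : uniq (i0 :: s).
  by apply: (@map_uniq _ _ z); rewrite /= zi0.
have dz k : 0 < 1 - z k * (z k)^* by rewrite -normCK subr_gt0 expr_lt1.
have w1 k : k \in i0 :: s -> `|w k| <= 1.
  move=> /(kpsd_diag us' wp); rewrite /pick_kernel pmulr_lge0 ?invr_gt0 //.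
  by rewrite -normCK subr_ge0 expr_le1.
have zn k : k \in s -> z k != z i0.
  by move=> sk; apply: contraNneq zi0 => <-; exact: map_f.
set c := w i0.
have c1 : `|c| <= 1 by apply: w1; rewrite mem_head.
(* If [|c| = 1] the diagonal entry at [i0] is 0, hence so is its whole row, which forces [w i = c]
   for all [i]: a constant solves the problem. *)
have [c1'|] := boolP (`|c| == 1).
  exists c%:P, 1; split=> [x _|i].
    by rewrite !hornerE oner_neq0 normr1.
  rewrite !hornerE inE => /orP[/eqP -> //|si].
  have ii0 : i != i0 by apply: contraNneq (zn _ si) => ->.
  have cc : c * c^* = 1 by rewrite -normCK (eqP c1') expr1n.
  have /eqP : pick_kernel z w i0 i = 0.
    apply: (kpsd_diag0 us' wp); rewrite ?inE ?si ?eqxx ?orbT //.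
      rewrite /pick_kernel rmorphM fmorphV !rmorphB !rmorphM /= !conjC1 !conjCK.
      by rewrite ![_^* * _]mulrC.
    by rewrite /pick_kernel cc subrr mul0r.
  rewrite mulf_eq0 invr_eq0 (negPf (disk_sub_neq0 (zD i0) _)) ?norm_conjC ?orbF //; last exact: ltW.
  rewrite subr_eq0 => /eqP e.
  have e2 : c^* * w i = 1 by rewrite -[RHS]conjC1 e rmorphM /= conjCK.
  by rewrite -[RHS]mul1r -cc -mulrA e2 mulr1.
move=> cn1; have {cn1} c1' : `|c| < 1 by rewrite lt_neqAle cn1.
have n k : k \in i0 :: s -> 1 - c^* * w k != 0.
  by move=> sk; rewrite disk_sub_neq0 ?norm_conjC ?w1.
pose F k := (w k - c) / (1 - c^* * w k).
pose G k := F k / bl z i0 k.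
have c2 : 1 - c^* * c != 0 by rewrite disk_sub_neq0 ?norm_conjC.
have FE k : k \in i0 :: s -> bl z i0 k * G k = F k.
  rewrite inE => /orP[/eqP ->|sk].
    by rewrite /F /G /bl !subrr !mul0r.
  rewrite mulrC mulfVK // mulf_neq0 ?subr_eq0 ?zn // invr_eq0.
  by rewrite disk_sub_neq0 ?norm_conjC // ltW.
have nF k : k \in i0 :: s -> 1 + c^* * (bl z i0 k * G k) != 0.
  move=> sk; rewrite FE //.
  have -> : 1 + c^* * F k = (1 - c^* * c) / (1 - c^* * w k).
    by rewrite /F; field; exact: n.
  by apply: mulf_neq0 => //; rewrite invr_eq0; exact: n.
have wE k : k \in i0 :: s ->
  w k = (bl z i0 k * G k + c) / (1 + c^* * (bl z i0 k * G k)).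
  move=> sk; have := nF _ sk; rewrite FE // => nf.
  apply: (canRL (mulfK nf)); rewrite /F.
  by field; exact: n.
have /IH [//|p [q [pq e]]] : kpsd s (pick_kernel z G).
  apply: (kpsd_pick_down (c := c) (i0 := i0)) => //.
  by apply: eq_kpsd wp => i j si sj; rewrite /pick_kernel (wE i) ?(wE j).
pose a := z i0.
(* Numerator and denominator of [(b G + c) / (1 + conj(c) b G)] with [b] the Blaschke factor at [a]
   and [G = p / q], after clearing denominators. *)
exists (('X - a%:P) * p + c%:P * (1 - (a^*)%:P * 'X) * q),
       ((1 - (a^*)%:P * 'X) * q + (c^*)%:P * ('X - a%:P) * p).
have h1 x : `|x| < 1 ->
  `|(x - a) * p.[x]| < `|(1 - a^* * x) * q.[x]|.
  move=> /[dup] x1 /pq[q0 pq1]; rewrite !normrM.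
  have aD : `|a| < 1 := zD i0.
  apply: (@le_lt_trans _ _ (`|x - a| * `|q.[x]|)); first exact: ler_wpM2l.
  rewrite ltr_pM2r ?normr_gt0 //; exact: blaschke_norm_lt.
split=> [x x1|i si].
  rewrite !hornerE.
  have := h1 x x1; set X := (x - a) * _; set Y := (1 - _) * q.[x] => XY.
  rewrite -!mulrA -/X -/Y; split; last exact/mobius_norm/ltW.
  rewrite addrC addr_eq0; apply/eqP => e'; move: XY.
  have : `|c^* * X| <= `|X| by rewrite normrM norm_conjC ler_piMl.
  by rewrite e' normrN => h /(le_lt_trans h); rewrite ltxx.
rewrite !hornerE -!mulrA.
have dz0 k : 1 - a^* * z k != 0 by rewrite disk_sub_neq0 ?norm_conjC ?(ltW (zD k)) ?(zD i0).
suff -> : (z i - a) * p.[z i] = F i * ((1 - a^* * z i) * q.[z i]).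
  by have := n i si; rewrite /F => ni; field.
move: si; rewrite inE => /orP[/eqP ->|si]; first by rewrite /F !subrr !mul0r.
rewrite e // -(FE i) ?inE ?si ?orbT // /bl -/a.
by field; exact: dz0.
Qed.

End Pick.

(** * The real-valued modulus *)

Section RealModulus.
Variable R : realType.
Implicit Types x y z : Cplx R.

(** The norm [|z|] has its values in the complex field; a modulus in [R] gives access to real
    topology and to [lra] and [nra]. *)
Definition nm z : R := Normc.normc z.

Lemma normE z : `|z| = (nm z)%:C. Proof. by []. Qed.

Lemma nm_ge0 z : 0 <= nm z. Proof. by case: z => a b; exact: sqrtr_ge0. Qed.

Lemma nmD x y : nm (x + y) <= nm x + nm y. Proof. exact: le_normcD. Qed.

Lemma nmM x y : nm (x * y) = nm x * nm y. Proof. exact: Normc.normcM. Qed.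

Lemma nmN x : nm (- x) = nm x. Proof. exact: normcN. Qed.

Lemma nmV x : nm x^-1 = (nm x)^-1. Proof. exact: Normc.normcV. Qed.

Lemma nm0 : nm 0 = 0. Proof. exact: Normc.normc0. Qed.

Lemma nm1 : nm 1 = 1. Proof. exact: Normc.normc1. Qed.

Lemma nm_eq0 x : (nm x == 0) = (x == 0).
Proof. by rewrite -(inj_eq (@complexI R)) -normE normr_eq0. Qed.

Lemma nmX x n : nm (x ^+ n) = nm x ^+ n.
Proof. by elim: n => [|n IH]; rewrite ?expr0 ?nm1 // !exprS nmM IH. Qed.

Lemma nm_conj x : nm x^* = nm x.
Proof. by apply: (@complexI R); rewrite -!normE norm_conjC. Qed.

Lemma nmB x y : nm x - nm y <= nm (x - y).
Proof. by rewrite lerBlDr -{1}(subrK y x) nmD. Qed.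

Lemma nm_distC x y : nm (x - y) = nm (y - x).
Proof. by rewrite -nmN opprB. Qed.

Lemma nm_sqr (z : Cplx R) : nm z ^+ 2 = complex.Re z ^+ 2 + complex.Im z ^+ 2.
Proof. by case: z => a b; rewrite /nm /= sqr_sqrtr // addr_ge0 ?sqr_ge0. Qed.

Lemma nmR (a : R) : nm a%:C = `|a|.
Proof. by rewrite /nm /= expr0n addr0 sqrtr_sqr. Qed.

Lemma norm_lt1 z : (`|z| < 1) = (nm z < 1).
Proof. by rewrite normE -(ltcR (nm z) 1). Qed.

Lemma norm_le1 z : (`|z| <= 1) = (nm z <= 1).
Proof. by rewrite normE -(lecR (nm z) 1). Qed.

Lemma nearC_nm (x : Cplx R) (P : Cplx R -> Prop) :
  (\forall y \near x, P y) <-> exists2 e : R, 0 < e & forall y, nm (y - x) < e -> P y.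
Proof.
split=> [/nbhs_ballP[e /= e0 eP]|[e e0 eP]].
  have eR : e = (complex.Re e)%:C by rewrite RRe_real // gtr0_real.
  exists (complex.Re e); first by rewrite -ltcR -eR.
  by move=> y yx; apply: eP; rewrite -ball_normE /= distrC normE eR ltcR.
apply/nbhs_ballP; exists e%:C; first by rewrite /= (ltcR 0 e).
by move=> y; rewrite -ball_normE /= distrC normE ltcR => /eP.
Qed.

Lemma continuous_nm : continuous (nm : Cplx R -> R).
Proof.
move=> x; apply/(@cvgrPdist_lt _ _ _ (nbhs x) (nbhs_filter x)) => e e0; apply/nearC_nm; exists e => // y yx.
apply: le_lt_trans yx; rewrite ler_norml; have := nmB x y; have := nmB y x.
by rewrite (nm_distC x y); lra.
Qed.

(** The disk is a closed subset of the continuous image of the square [[-r, r]^2]. *)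
Lemma compact_disk (r : R) : compact [set z : Cplx R | nm z <= r].
Proof.
pose phi (p : R * R) : Cplx R := p.1 +i* p.2.
have phic : continuous phi.
  move=> p; apply/cvgrPdist_lt => e e0.
  have h1 : (fst : R * R -> R) q @[q --> p] --> p.1 by exact: cvg_fst.
  have h2 : (snd : R * R -> R) q @[q --> p] --> p.2 by exact: cvg_snd.
  have eR : e = (complex.Re e)%:C by rewrite RRe_real // gtr0_real.
  have e2 : 0 < complex.Re e by rewrite -ltcR -eR.
  near=> q; rewrite eR normE ltcR.
  have -> : phi p - phi q = (p.1 - q.1)%:C + 'i%C * (p.2 - q.2)%:C.
    by rewrite /phi /=; apply/eqP; rewrite eq_complex /=; apply/andP; split; apply/eqP; ring.
  apply: le_lt_trans (nmD _ _) _; rewrite nmM !nmR.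
  have -> : nm 'i%C = 1 by rewrite /nm /= expr0n expr1n add0r sqrtr1.
  rewrite mul1r.
  have [d1 d2] : `|p.1 - q.1| < complex.Re e / 2 /\ `|p.2 - q.2| < complex.Re e / 2.
    near: q; apply: filterI.
      by move/cvgrPdist_lt: h1; apply; lra.
    by move/cvgrPdist_lt: h2; apply; lra.
  lra.
have ck := continuous_compact (continuous_subspaceT phic)
  (compact_setX (@segment_compact R (- r) r) (@segment_compact R (- r) r)).
apply: (subclosed_compact _ ck).
  by apply: (@closed_comp _ _ nm [set x : R | x <= r]);
    [move=> z _; exact: continuous_nm | exact: closed_le].
move=> z /= zr; exists (complex.Re z, complex.Im z); last by case: z zr.
have := nm_sqr z; have := nm_ge0 z => n0 ns.
by split; rewrite /= in_itv /=; apply/andP; split; nra.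
Unshelve. all: by end_near. Qed.

End RealModulus.

(** * Functions with Peano expansions of every order *)

Section BigO.
Variable R : realType.
Local Notation C := (Cplx R).
Implicit Types (g f : C -> C) (p q : {poly C}) (c : C).

Definition bigO0 (N : nat) g := exists M r : R,
  [/\ 0 <= M, 0 < r & forall h, nm h < r -> nm (g h) <= M * nm h ^+ N].

Lemma eq_bigO0 N g g' (r : R) :
  0 < r -> (forall h, nm h < r -> g h = g' h) -> bigO0 N g -> bigO0 N g'.
Proof.
move=> r0 e [M [r' [M0 r'0 H]]]; exists M, (Num.min r r').
by split=> [//||h]; rewrite lt_min ?r0 // => /andP[h1 h2]; rewrite -e // H.
Qed.

Lemma bigO0_weaken N N' g : (N' <= N)%N -> bigO0 N g -> bigO0 N' g.
Proof.
move=> NN [M [r [M0 r0 H]]]; exists M, (Num.min r 1).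
split=> [//||h]; rewrite lt_min ?r0 ?ltr01 // => /andP[h1 h2].
apply: le_trans (H _ h1) _; rewrite ler_wpM2l //.
by apply: ler_wiXn2l => //; [exact: nm_ge0 | exact: ltW].
Qed.

Lemma bigO0D N g g' : bigO0 N g -> bigO0 N g' -> bigO0 N (fun h => g h + g' h).
Proof.
move=> [M [r [M0 r0 H]]] [M' [r' [M'0 r'0 H']]].
exists (M + M'), (Num.min r r').
split=> [||h]; rewrite ?addr_ge0 // lt_min ?r0 // => /andP[h1 h2].
by apply: le_trans (nmD _ _) _; rewrite mulrDl lerD ?H ?H'.
Qed.

Lemma bigO0M N N' g g' :
  bigO0 N g -> bigO0 N' g' -> bigO0 (N + N') (fun h => g h * g' h).
Proof.
move=> [M [r [M0 r0 H]]] [M' [r' [M'0 r'0 H']]].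
exists (M * M'), (Num.min r r').
split=> [||h]; rewrite ?mulr_ge0 // lt_min ?r0 // => /andP[h1 h2].
by rewrite nmM exprD mulrACA ler_pM ?nm_ge0 ?H ?H'.
Qed.

Lemma bigO0N N g : bigO0 N g -> bigO0 N (fun h => - g h).
Proof.
by move=> [M [r [M0 r0 H]]]; exists M, r; split=> // h /H; rewrite nmN.
Qed.

Lemma bigO0_cst c : bigO0 0 (fun=> c).
Proof.
by exists (nm c), 1; split=> [||h _]; rewrite ?nm_ge0 ?ltr01 ?expr0 ?mulr1.
Qed.

Lemma bigO0_id : bigO0 1 id.
Proof. by exists 1, 1; split=> // h _; rewrite mul1r expr1. Qed.

Lemma bigO0_poly p : bigO0 0 (horner p).
Proof.
elim/poly_ind: p => [|p c IH].
  by apply: (eq_bigO0 ltr01) (bigO0_cst 0) => h _; rewrite horner0.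
apply: (@eq_bigO0 _ (fun h => p.[h] * h + c) _ 1) => //.
  by move=> h _; rewrite hornerMXaddC.
apply: bigO0D (bigO0_cst c).
exact: bigO0_weaken (bigO0M IH bigO0_id).
Qed.

Lemma bigO0_Xn N : bigO0 N (fun h => h ^+ N).
Proof. by exists 1, 1; split=> // h _; rewrite mul1r nmX. Qed.

(** Stands in for analyticity at [c]. It passes to products, inverses and quotients by [x - a] by
    mere polynomial algebra, and order 3 suffices for the maximum principle. *)
Definition peano f c := forall N, exists p, bigO0 N (fun h => f (c + h) - p.[h]).

Lemma eq_peano f g c (r : R) :
  0 < r -> (forall h, nm h < r -> f (c + h) = g (c + h)) -> peano f c -> peano g c.
Proof.
move=> r0 e fp N; have [p pf] := fp N; exists p.
by apply: (eq_bigO0 r0 _ pf) => h hr; rewrite e.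
Qed.

Lemma peano_bounded f c : peano f c -> bigO0 0 (fun h => f (c + h)).
Proof.
move=> /(_ 0%N)[p pf]; apply: eq_bigO0 (bigO0D pf (bigO0_poly p)) => // h _.
by rewrite subrK.
Qed.

Lemma peano_horner0 f c p N : bigO0 N.+1 (fun h => f (c + h) - p.[h]) -> p.[0] = f c.
Proof.
move=> [M [r [M0 r0 H]]]; have := H 0; rewrite nm0 => /(_ r0).
rewrite expr0n mulr0 addr0 => fp; apply/esym/eqP.
by rewrite -subr_eq0 -nm_eq0 eq_le fp nm_ge0.
Qed.

Lemma bigO0_poly0 p : bigO0 1 (fun h => p.[h] - p.[0]).
Proof.
elim/poly_ind: p => [|p c IH].
  by exists 0, 1; split=> // h _; rewrite !horner0 subrr nm0 mul0r.
apply: (@eq_bigO0 _ (fun h => p.[h] * h) _ 1) => //.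
  by move=> h _; rewrite !hornerMXaddC mulr0 add0r addrK.
exact: bigO0M (bigO0_poly p) bigO0_id.
Qed.

Lemma peano_continuous f c : peano f c -> bigO0 1 (fun h => f (c + h) - f c).
Proof.
move=> /(_ 1%N)[p pf]; rewrite -(peano_horner0 pf).
apply: eq_bigO0 (bigO0D pf (bigO0_poly0 p)) => // h _.
by rewrite addrA subrK.
Qed.

Lemma peano_cst a c : peano (fun=> a) c.
Proof.
move=> N; exists a%:P; exists 0, 1; split=> // h _.
by rewrite hornerC subrr nm0 mul0r.
Qed.

Lemma peano_id c : peano id c.
Proof.
move=> N; exists ('X + c%:P); exists 0, 1; split=> // h _.
by rewrite !hornerE (addrC c) subrr nm0.
Qed.

Lemma peanoM f g c : peano f c -> peano g c -> peano (fun x => f x * g x) c.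
Proof.
move=> fp gp N; have [p pf] := fp N; have [q qg] := gp N; exists (p * q).
have h1 := bigO0M pf (peano_bounded gp); have h2 := bigO0M (bigO0_poly p) qg.
rewrite addn0 in h1; apply: eq_bigO0 (bigO0D h1 h2) => // h _.
by rewrite hornerM; ring.
Qed.

Lemma peanoB f g c : peano f c -> peano g c -> peano (fun x => f x - g x) c.
Proof.
move=> fp gp N; have [p pf] := fp N; have [q qg] := gp N; exists (p - q).
apply: eq_bigO0 (bigO0D pf (bigO0N qg)) => // h _; rewrite hornerD hornerN; ring.
Qed.

(** A polynomial that does not vanish at 0 is coprime to ['X^N], so Bezout inverts it modulo
    ['X^N]. *)
Lemma poly_inv_mod p N : p.[0] != 0 -> exists q s, p * q = 1 + 'X^N * s.
Proof.
move=> p0; have : coprimep p 'X^N.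
  by rewrite coprimep_expr // coprimepX rootE.
move/Bezout_eq1_coprimepP => [[u v] /= e]; exists u, (- v).
by rewrite -e; ring.
Qed.

Lemma peano_neq0 f c : peano f c -> f c != 0 ->
  exists2 r : R, 0 < r & forall h, nm h < r -> nm (f c) / 2 <= nm (f (c + h)).
Proof.
move=> /peano_continuous[M [r [M0 r0 H]]] f0.
have n0 : 0 < nm (f c) by rewrite lt_def nm_eq0 f0 nm_ge0.
exists (Num.min r (nm (f c) / (2 * (M + 1)))).
  by rewrite lt_min r0 divr_gt0 // mulr_gt0 //; lra.
move=> h; rewrite lt_min => /andP[/H hr]; rewrite expr1 in hr.
rewrite ltr_pdivlMr; last by lra.
move=> h2; have := nmB (f c) (f (c + h)); rewrite nm_distC => h3.
have h4 := nm_ge0 h; nra.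
Qed.

(** If [p] expands [f] and [p q = 1 + X^N s], then [1/f - q = - (1/f) (X^N s + (f - p) q)]. *)
Lemma peanoV f c : peano f c -> f c != 0 -> peano (fun x => (f x)^-1) c.
Proof.
(* Order [N.+1] rather than [N]: a positive order is what forces [p.[0] = f c], also when
   [N = 0]. *)
move=> fp f0 N; have [p pf] := fp N.+1.
have p0 : p.[0] != 0 by rewrite (peano_horner0 pf).
have [q [s e]] := poly_inv_mod N p0; exists q.
have [r r0 rf] := peano_neq0 fp f0.
have n0 : 0 < nm (f c) by rewrite lt_def nm_eq0 f0 nm_ge0.
have iO : bigO0 0 (fun h => (f (c + h))^-1).
  exists (2 / nm (f c)), r; split=> // [|h hr]; first by rewrite divr_ge0 ?nm_ge0.
  rewrite expr0 mulr1 nmV -[_ / _]invrK lef_pV2 ?posrE ?invr_gt0 ?divr_gt0 //.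
    by rewrite invf_div rf.
  by apply: lt_le_trans (rf _ hr); rewrite divr_gt0.
have sO := bigO0M (bigO0_Xn N) (bigO0_poly s).
have pfq := bigO0M (bigO0_weaken (leqnSn N) pf) (bigO0_poly q).
rewrite addn0 in sO pfq.
have := bigO0M iO (bigO0N (bigO0D sO pfq)).
rewrite add0n; apply: eq_bigO0 r0 _ => h hr.
have fh0 : f (c + h) != 0.
  by rewrite -nm_eq0 gt_eqF // (lt_le_trans _ (rf _ hr)) // divr_gt0.
have := congr1 (fun P : {poly C} => P.[h]) e.
rewrite hornerM hornerD hornerM hornerXn hornerC => eh.
have -> : h ^+ N * s.[h] = p.[h] * q.[h] - 1 by rewrite eh; ring.
by field.
Qed.

Lemma bigO0_deriv_unique (a b : C) : bigO0 2 (fun h => a * h - b * h) -> a = b.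
Proof.
move=> [M [r [M0 r0 H]]]; apply/eqP; rewrite -subr_eq0 -nm_eq0.
apply/negPn/negP => n0; have {}n0 : 0 < nm (a - b) by rewrite lt_def n0 nm_ge0.
pose e := Num.min (r / 2) (nm (a - b) / (2 * (M + 1))).
have e0 : 0 < e by rewrite lt_min !divr_gt0 //; lra.
have er : e < r by rewrite gt_min; apply/orP; left; lra.
have eM : e * (2 * (M + 1)) <= nm (a - b).
  by rewrite -ler_pdivlMr ?ge_min ?lexx ?orbT //; lra.
have ee : nm (e%:C : C) = e by rewrite nmR gtr0_norm.
have := H e%:C; rewrite ee => /(_ er); rewrite -mulrBl nmM ee.
nra.
Qed.

Lemma poly_linear p : exists q : {poly C}, p = p.[0]%:P + p`_1 *: 'X + 'X^2 * q.
Proof.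
exists (drop_poly 2 p); rewrite -{1}(poly_take_drop 2 p) mulrC; congr (_ + _).
apply/polyP => i; rewrite coef_take_poly !coefE horner_coef0.
by case: i => [|[|i]] //=; rewrite ?(mulr0, mulr1, addr0, add0r).
Qed.

Lemma peano_linear f c p N : bigO0 N.+2 (fun h => f (c + h) - p.[h]) ->
  bigO0 2 (fun h => f (c + h) - (f c + p`_1 * h)).
Proof.
move=> pf; have p0 := peano_horner0 pf.
have [q e] := poly_linear p.
have := bigO0D (bigO0_weaken (isT : 2 <= N.+2)%N pf) (bigO0M (bigO0_Xn 2) (bigO0_poly q)).
apply: eq_bigO0 (ltr01) _ => h _; rewrite {1}e !hornerE p0; ring.
Qed.

(** At [a] the quotient takes the linear coefficient of [f], which by uniqueness is the same in
    expansions of all orders; dividing an expansion of [f] by [h] then expands the quotient. *)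
Lemma peano_div f a : (forall c, nm c < 1 -> peano f c) -> nm a < 1 -> f a = 0 ->
  exists2 G, (forall c, nm c < 1 -> peano G c) &
    forall x, f x = (x - a) * G x.
Proof.
move=> fp aD fa; have [p2 pf2] := fp a aD 2%N.
pose G x := if x == a then p2`_1 else f x / (x - a).
exists G; last first.
  move=> x; rewrite /G; case: eqP => [->|/eqP xa]; first by rewrite subrr mul0r.
  by rewrite mulrC divfK // subr_eq0.
move=> c cD; have [->|ca] := eqVneq c a.
  (* Order at least 2 identifies the linear coefficient; the later division by [h] uses only order
     [N.+1]. *)
  move=> N; have [p pf] := fp a aD N.+2.
  have p1 : p`_1 = p2`_1.
    apply: bigO0_deriv_unique.
    apply: eq_bigO0 (bigO0D (peano_linear pf2) (bigO0N (peano_linear pf))) => // h _.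
    by ring.
  have p0 : p.[0] = 0 by rewrite (peano_horner0 pf).
  have [q e] := poly_linear p.
  exists ((p`_1)%:P + 'X * q).
  have [M [r [M0 r0 H]]] := bigO0_weaken (leqnSn N.+1) pf.
  exists M, r; split=> // h hr; rewrite !hornerE.
  have [->|h0] := eqVneq h 0.
    rewrite addr0 /G eqxx -p1 mul0r addr0 subrr nm0 mulr_ge0 // exprn_ge0 //; exact: nm_ge0.
  have nh : 0 < nm h by rewrite lt_def nm_eq0 h0 nm_ge0.
  have -> : G (a + h) = f (a + h) / h.
    by rewrite /G -subr_eq0 addrAC subrr add0r (negPf h0).
  rewrite -(ler_pM2r nh) -mulrA -exprSr; apply: le_trans (H _ hr).
  rewrite -nmM [X in _ - X.[h]]e p0 !hornerE le_eqVlt; apply/orP; left; apply/eqP.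
  by congr nm; field.
have d0 : c - a != 0 by rewrite subr_eq0.
have dp : peano (fun x => x - a) c := peanoB (peano_id c) (peano_cst a c).
have [r r0 rf] := peano_neq0 dp d0.
apply: eq_peano r0 _ (peanoM (fp c cD) (peanoV dp d0)) => h hr.
rewrite /G; case: eqP => // e; move: (rf _ hr); rewrite e subrr nm0.
have : 0 < nm (c - a) by rewrite lt_def nm_eq0 d0 nm_ge0.
by move=> n0 n1; exfalso; lra.
Qed.

End BigO.

(** * Power series have Peano expansions; no interior maximum *)

Section LocalExpansion.
Variable R : realType.
Local Notation C := (Cplx R).
Implicit Types (f g G : C -> C) (c : C).

Lemma cvgC_nm (u : nat -> C) (l : C) (e : R) : u @ \oo --> l -> 0 < e ->
  exists n0, forall n, (n0 <= n)%N -> nm (u n - l) < e.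
Proof.
move=> /cvgrPdist_lt ul e0; have eC : 0 < e%:C :> C by rewrite (ltcR 0 e).
have [n0 _ H] := ul _ eC; exists n0 => n nn.
by have := H n nn; rewrite /= distrC normE ltcR.
Qed.

(** Convergence at [r / 2] bounds the terms there, so for [|h| < r / 4] the tail is dominated by a
    geometric series of ratio at most [1 / 2]. *)
Lemma peano_powerseries f c (a : nat -> C) (r : R) : 0 < r ->
  (forall h, nm h < r -> series (fun k => a k * h ^+ k) @ \oo --> f (c + h)) ->
  peano f c.
Proof.
move=> r0 H N.
pose r2 := r / 2; have r20 : 0 < r2 by rewrite divr_gt0.
have nr2 : nm (r2%:C : C) = r2 by rewrite nmR gtr0_norm.
(* Two consecutive partial sums within 1 of the limit differ by at most 2. *)
have [n0 n0P] : exists n0, forall n, (n0 <= n)%N -> nm (a n) * r2 ^+ n <= 2.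
  have := H r2%:C; rewrite nr2 => /(_ ltac:(rewrite /r2; lra)) /cvgC_nm /(_ ltr01)[n0 h].
  exists n0 => n nn; have h1 := h n nn; have h2 := h n.+1 (leqW nn).
  have := nmD (series (fun k => a k * r2%:C ^+ k) n.+1 - f (c + r2%:C))
    (- (series (fun k => a k * r2%:C ^+ k) n - f (c + r2%:C))).
  rewrite nmN opprB addrA subrK {1}/series /= big_nat_recr //= -/(series _ _).
  rewrite addrAC subrr add0r nmM nmX nr2; lra.
pose K := maxn N n0; exists (\poly_(k < K) a k).
apply: (@bigO0_weaken _ K); first exact: leq_maxl.
exists (4 / r2 ^+ K), (r2 / 2); split=> [||h hr].
- by rewrite divr_ge0 // exprn_ge0 // ltW.
- by rewrite divr_gt0.
pose x := nm h / r2.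
have x0 : 0 <= x by rewrite divr_ge0 ?nm_ge0 // ltW.
have x2 : x <= 1 / 2 by rewrite ler_pdivrMr //; lra.
have hE : nm h = x * r2 by rewrite divfK // gt_eqF.
have -> : 4 / r2 ^+ K * nm h ^+ K = 4 * x ^+ K.
  by rewrite hE [(x * r2) ^+ _]exprMn mulrACA mulVf ?mulr1 // expf_neq0 // gt_eqF.
(* The tail of [2 x^k] is at most twice its first term as [x <= 1/2]; subtracting [4 x^(K + m)]
   makes the induction on [m] close. *)
have bound m : nm (series (fun k => a k * h ^+ k) (K + m)%N - (\poly_(k < K) a k).[h])
    <= 4 * x ^+ K - 4 * x ^+ (K + m).
  elim: m => [|m IH].
    rewrite addn0 subrr horner_poly /series /= big_mkord subrr nm0 //.
  rewrite addnS {1}/series /= big_nat_recr //= -/(series _ _) addrAC.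
  apply: le_trans (nmD _ _) _; rewrite nmM nmX hE.
  have := n0P (K + m)%N (leq_trans (leq_maxr _ _) (leq_addr _ _)).
  have xk : 0 <= x ^+ (K + m) by rewrite exprn_ge0.
  rewrite [(x * r2) ^+ _]exprMn exprS mulrCA => an.
  have h1 : x ^+ (K + m) * (nm (a (K + m)%N) * r2 ^+ (K + m)) <= x ^+ (K + m) * 2.
    exact: ler_wpM2l.
  have h2 : x * x ^+ (K + m) <= 1 / 2 * x ^+ (K + m) by exact: ler_wpM2r.
  lra.
apply/ler_addgt0Pr => e e0.
have hr' : nm h < r by apply: lt_trans hr _; rewrite /r2; lra.
have [n1 n1P] := cvgC_nm (H h hr') e0.
have b1 := bound n1; have b2 := n1P (K + n1)%N (leq_addl _ _).
have := nmD (f (c + h) - series (fun k => a k * h ^+ k) (K + n1)%N)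
   (series (fun k => a k * h ^+ k) (K + n1)%N - (\poly_(k < K) a k).[h]).
rewrite addrA subrK [nm (f _ - _)]nm_distC => b3.
have xk : 0 <= x ^+ (K + n1) by rewrite exprn_ge0.
by move: b2 b1; rewrite nm_distC; lra.
Qed.

Lemma analytic_peano (U : set C) f c : analytic_on U f -> U c -> peano f c.
Proof.
move=> fa /fa[a /nearC_nm[r r0 H]]; apply: (peano_powerseries (a := a) r0) => h hr.
have := H (c + h); rewrite addrAC subrr add0r; exact.
Qed.

Lemma nm_parallelogram (x y : C) :
  nm (x + y) ^+ 2 + nm (x - y) ^+ 2 = 2 * nm x ^+ 2 + 2 * nm y ^+ 2.
Proof. by case: x y => [a b] [a' b']; rewrite !nm_sqr /=; ring. Qed.

Lemma nm_sqr_perturb (x e : C) : nm x ^+ 2 - 2 * nm x * nm e <= nm (x + e) ^+ 2.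
Proof.
have := nmB x (- e); rewrite nmN opprK => h.
have := nm_ge0 x; have := nm_ge0 e; have := nm_ge0 (x + e) => h1 h2 h3.
have [h4|h4] := lerP (nm e) (nm x); last by nra.
have : (nm x - nm e) ^+ 2 <= nm (x + e) ^+ 2 by rewrite ler_sqr ?nnegrE //; lra.
by nra.
Qed.

(** Over [h] in [{t, -t, it, -it}] both [h] and [h^2] have mean 0. Hence the mean of
    [|a0 + a1 h + a2 h^2|^2] is at least [|a0|^2], that of [eta |c + h|^2] exceeds [eta |c|^2] by
    [eta t^2], and the remainder costs only a multiple of [t^3]. *)
Lemma peano_no_local_max f c (eta r : R) : peano f c -> 0 < eta -> 0 < r ->
  ~ (forall h, nm h < r -> nm (f (c + h)) ^+ 2 + eta * nm (c + h) ^+ 2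
                          <= nm (f c) ^+ 2 + eta * nm c ^+ 2).
Proof.
move=> fp eta0 r0 max.
have [p pf] := fp 3%N.
have [q e] := poly_linear p; have [q' e'] := poly_linear q.
have [a0 [a1 [a2 [M [s [M0 s0 H]]]]]] : exists a0 a1 a2 : C, exists M s : R,
  [/\ 0 <= M, 0 < s & forall h, nm h < s ->
     nm (f (c + h) - (a0 + a1 * h + a2 * h ^+ 2)) <= M * nm h ^+ 3].
  exists p.[0], (p`_1), q.[0].
  have := bigO0D pf (bigO0D (bigO0M (bigO0_Xn R 3) (bigO0_cst (q`_1)))
     (bigO0_weaken (isT : 3 <= 4)%N (bigO0M (bigO0_Xn R 4) (bigO0_poly q')))).
  move=> [M [s [M0 s0 H]]]; exists M, s; split=> // h hs.
  apply: le_trans (H h hs); rewrite le_eqVlt; apply/orP; left; apply/eqP.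
  have ep : p.[h] = p.[0] + p`_1 * h + h ^+ 2 * q.[h] by rewrite {1}e !hornerE.
  have eq : q.[h] = q.[0] + q`_1 * h + h ^+ 2 * q'.[h] by rewrite {1}e' !hornerE.
  by congr nm; rewrite ep eq; ring.
have fc : f c = a0.
  have := H 0; rewrite nm0 => /(_ s0); rewrite !addr0 expr0n !mulr0 !addr0.
  rewrite expr0n mulr0 => h; apply/eqP; rewrite -subr_eq0 -nm_eq0 eq_le h.
  exact: nm_ge0.
pose B := nm a0 + nm a1 + nm a2.
have B0 : 0 <= B by rewrite !addr_ge0 ?nm_ge0.
pose d := 2 * (B * M + 1).
have d0 : 0 < d by rewrite mulr_gt0 // ltr_wpDl ?mulr_ge0.
(* Besides lying in both radii, [t <= 1] makes [B] a bound for the quadratic part, and [t d <= eta]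
   makes the error [2 B M t^3] smaller than the gain [eta t^2]. *)
pose t := Num.min (Num.min (r / 2) (s / 2)) (Num.min 1 (eta / d)).
have t0 : 0 < t by rewrite !lt_min !divr_gt0 // ltr01.
have tr : t < r by rewrite !gt_min; apply/orP; left; apply/orP; left; lra.
have ts : t < s by rewrite !gt_min; apply/orP; left; apply/orP; right; lra.
have t1 : t <= 1 by rewrite !ge_min lexx orbT.
have tM : t * d <= eta by rewrite -ler_pdivlMr // !ge_min lexx !orbT.
have low h : nm h = t ->
  nm (a0 + a1 * h + a2 * h ^+ 2) ^+ 2 + eta * nm (c + h) ^+ 2 - 2 * B * M * t ^+ 3
   <= nm (f c) ^+ 2 + eta * nm c ^+ 2.
  move=> ht; have := max h; rewrite ht => /(_ tr); apply: le_trans.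
  rewrite addrAC lerD2r.
  have E := H h; rewrite ht in E; have {}E := E ts.
  set T := a0 + _ + _ in E *.
  have -> : f (c + h) = T + (f (c + h) - T) by ring.
  apply: le_trans (nm_sqr_perturb _ _).
  have TB : nm T <= B.
    apply: le_trans (nmD _ _) _; rewrite lerD //.
      by apply: le_trans (nmD _ _) _; rewrite lerD // nmM ht ler_piMr ?nm_ge0.
    by rewrite nmM nmX ht ler_piMr ?nm_ge0 // expr_le1 // ltW.
  have := nm_ge0 T; have := nm_ge0 (f (c + h) - T).
  have t3 : 0 <= t ^+ 3 by rewrite exprn_ge0 // ltW.
  move: (nm (f _ - T)) (nm T) (t ^+ 3) E TB t3 => E' T' t3 E TB t30 E0 T0.
  have : T' * E' <= B * (M * t3) by rewrite ler_pM.
  by lra.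
have nt : nm (t%:C : C) = t by rewrite nmR gtr0_norm.
have ni : nm ('i%C : C) = 1 by rewrite /nm /= expr0n expr1n add0r sqrtr1.
have l1 := low t%:C nt.
have l2 := low (- t%:C) ltac:(by rewrite nmN).
have nit : nm ('i%C * t%:C : C) = t by rewrite nmM ni mul1r.
have l3 := low ('i%C * t%:C) nit.
have l4 := low (- ('i%C * t%:C)) ltac:(by rewrite nmN).
have i2 : ('i%C * t%:C) ^+ 2 = - (t%:C ^+ 2) :> C.
  by rewrite exprMn sqr_i mulN1r.
move: l1 l2 l3 l4; rewrite !sqrrN i2.
have pc1 := nm_parallelogram c t%:C; have pc2 := nm_parallelogram c ('i%C * t%:C).
(* Opposite points pair up by the parallelogram law around [a0 + a2 t^2] and [a0 - a2 t^2], and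
   these two pair up around [a0]. *)
have p1 := nm_parallelogram (a0 + a2 * t%:C ^+ 2) (a1 * t%:C).
have p2 := nm_parallelogram (a0 - a2 * t%:C ^+ 2) (a1 * ('i%C * t%:C)).
have p3 := nm_parallelogram a0 (a2 * t%:C ^+ 2).
rewrite !mulrN [a0 + _ - a2 * _]addrAC [a0 + _ + _]addrAC.
rewrite [a0 - a1 * _ + a2 * _]addrAC [a0 - _ - _]addrAC.
rewrite nt in pc1; rewrite nit in pc2; rewrite fc.
have := sqr_ge0 (nm (a1 * t%:C)); have := sqr_ge0 (nm (a1 * ('i%C * t%:C))).
have := sqr_ge0 (nm (a2 * t%:C ^+ 2)).
have tt : 0 < t ^+ 2 by rewrite exprn_gt0.
have t3 : t ^+ 3 * d <= eta * t ^+ 2 by rewrite exprSr -mulrA mulrC ler_pM2r.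
have t30 : 0 < t ^+ 3 by rewrite exprn_gt0.
move: p1 p2 p3 pc1 pc2 t3; rewrite /d.
move: (nm _) (nm _) (nm _) (nm _) (nm _) (nm _) (nm _) (nm _) => *.
nra.
Qed.

End LocalExpansion.

(** * The maximum principle and the necessary condition *)

Section MaximumPrinciple.
Variable R : realType.
Local Notation C := (Cplx R).
Implicit Types (f g G : C -> C) (c : C).

Lemma peano_cvg f c : peano f c -> f @ c --> f c.
Proof.
move=> /peano_continuous[M [r [M0 r0 H]]].
apply/(@cvgrPdist_lt _ _ _ (nbhs c) (nbhs_filter c)) => e e0.
have eR : e = (complex.Re e)%:C by rewrite RRe_real // gtr0_real.
have e2 : 0 < complex.Re e by rewrite -ltcR -eR.
apply/nearC_nm; exists (Num.min r (complex.Re e / (M + 1))).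
  by rewrite lt_min r0 divr_gt0 //; lra.
move=> y; rewrite lt_min => /andP[y1 y2].
have := H _ y1; rewrite [c + _]addrC subrK expr1 => yM.
rewrite distrC eR normE ltcR; apply: le_lt_trans yM _.
by rewrite ltr_pdivlMr in y2; have := nm_ge0 (y - c); nra.
Qed.

(** The bound is assumed only asymptotically at the circle. If it failed at [z0], the perturbation
    [u = |G|^2 + d |x|^2] would attain its maximum over a closed disk either in the outer annulus,
    where it is too small, or at an interior point, which is impossible. *)
Lemma max_principle G :
  (forall c, nm c < 1 -> peano G c) ->
  (forall e : R, 0 < e -> exists2 rho : R, rho < 1 &
     forall x, rho < nm x -> nm x < 1 -> nm (G x) ^+ 2 <= 1 + e) ->
  forall x, nm x < 1 -> nm (G x) <= 1.
Proof.
move=> Gp bd z0 z1; rewrite leNgt; apply/negP => Gz.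
have Gz2 : 1 < nm (G z0) ^+ 2 by rewrite exprn_egt1.
(* With this [d], [u] is at least [1 + 4 d] at [z0] and at most [1 + 2 d] on the annulus. *)
pose d := (nm (G z0) ^+ 2 - 1) / 4.
have d0 : 0 < d by rewrite /d; lra.
have [rho rho1 bdr] := bd d d0.
pose r1 := (1 + Num.max rho (nm z0)) / 2.
have mx : Num.max rho (nm z0) < 1 by rewrite gt_max rho1.
have mxl : rho <= Num.max rho (nm z0) by rewrite le_max lexx.
have mxr : nm z0 <= Num.max rho (nm z0) by rewrite le_max lexx orbT.
have rr : rho < r1 by rewrite /r1; lra.
have zr : nm z0 < r1 by rewrite /r1; lra.
have r11 : r1 < 1 by rewrite /r1; lra.
pose u (x : C) : R := nm (G x) ^+ 2 + d * nm x ^+ 2.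
have cu : {within [set x : C | nm x <= r1], continuous u}.
  apply: continuous_in_subspaceT => x; rewrite inE /= => xr.
  have x1 : nm x < 1 by exact: le_lt_trans xr r11.
  have c1 : (fun y => nm (G y)) @ x --> nm (G x).
    by apply: continuous_comp (peano_cvg (Gp _ x1)) _; exact: continuous_nm.
  have c2 := @continuous_nm R x.
  have -> : u = (fun y => nm (G y) * nm (G y) + d * (nm y * nm y)).
    by apply/funext => y; rewrite /u !expr2.
  have FF := nbhs_filter x.
  apply: (@cvgD _ _ _ (nbhs x) FF); first exact: (@cvgM _ _ (nbhs x) FF).
  apply: (@cvgM _ _ (nbhs x) FF); first exact: cvg_cst.
  exact: (@cvgM _ _ (nbhs x) FF).
have [|c cr cmax] := compact_EVT_max _ (@compact_disk R r1) cu.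
  by exists z0; rewrite /= ltW.
rewrite inE /= in cr.
have c1 : nm c < 1 by exact: le_lt_trans cr r11.
have uz : u z0 <= u c by apply: cmax; rewrite inE /= ltW.
have [rc|rc] := ltrP rho (nm c).
  have := bdr c rc c1; move: uz; rewrite /u => uz Gc.
  have h1 : d * nm c ^+ 2 <= d by apply: ler_piMr; [exact: ltW | rewrite expr_le1 ?nm_ge0 // ltW].
  have h2 : 0 <= d * nm z0 ^+ 2 by rewrite mulr_ge0 ?sqr_ge0 // ltW.
  have h3 : nm (G z0) ^+ 2 = 1 + 4 * d by rewrite /d; field.
  by rewrite h3 in uz; lra.
have rs : 0 < r1 - nm c by lra.
apply: (peano_no_local_max (Gp c c1) d0 rs) => h hr.
apply: cmax; rewrite inE /=; have := nmD c h; lra.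
Qed.

Lemma blaschke_nm_sqr (a x : C) :
  nm (1 - a^* * x) ^+ 2 = nm (x - a) ^+ 2 + (1 - nm x ^+ 2) * (1 - nm a ^+ 2).
Proof.
apply: (@complexI R); rewrite !(rmorphXn, rmorphB, rmorphD, rmorphM, rmorph1) /= -!normE.
by rewrite !normCK !rmorphB /= rmorphM /= conjCK conjC1; ring.
Qed.

Lemma disk_sub_conj_neq0 (a x : C) : nm a < 1 -> nm x < 1 -> 1 - a^* * x != 0.
Proof.
move=> a1 x1; apply: disk_sub_neq0; rewrite ?norm_conjC ?norm_lt1 ?norm_le1 //.
exact: ltW.
Qed.

(** The Schwarz lemma at an arbitrary zero: the modulus of the Blaschke factor tends to 1 at the
    circle, so the quotient meets the asymptotic bound of [max_principle]. *)
Lemma schwarz_div f a :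
  (forall c, nm c < 1 -> peano f c) -> (forall x, nm x < 1 -> nm (f x) <= 1) ->
  nm a < 1 -> f a = 0 ->
  exists G, [/\ forall c, nm c < 1 -> peano G c,
    forall x, nm x < 1 -> nm (G x) <= 1 &
    forall x, nm x < 1 -> f x = (x - a) / (1 - a^* * x) * G x].
Proof.
move=> fp f1 a1 fa; have [G0 G0p fE] := peano_div fp a1 fa.
pose G x := G0 x * (1 - a^* * x).
have Gp c : nm c < 1 -> peano G c.
  move=> c1; apply: peanoM (G0p c c1) _; apply: peanoB (peano_cst _ _) _.
  exact: peanoM (peano_cst _ _) (peano_id _).
exists G; split=> // [|x x1]; last first.
  by rewrite fE /G; field; exact: disk_sub_conj_neq0.
apply: max_principle Gp _ => e e0.
pose m := (1 - nm a) / 2; have m0 : 0 < m by rewrite /m; lra.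
(* The first radius gives [|x - a| >= m], the second [1 - |x|^2 <= e m^2]; together
   [|1 - conj(a) x|^2 <= (1 + e) |x - a|^2]. *)
exists (Num.max (1 - m) (1 - e * m ^+ 2 / 2)).
  by rewrite gt_max; apply/andP; split; rewrite ltrBlDr ltrDl // divr_gt0 // mulr_gt0 // exprn_gt0.
move=> x; rewrite gt_max => /andP[xm xe] x1.
have am : m <= nm (x - a) by have := nmB x a; rewrite /m in xm *; lra.
have := f1 x x1; rewrite fE nmM /G nmM exprMn blaschke_nm_sqr => Ag.
have [n0 n1 n2] := And3 (nm_ge0 (G0 x)) (nm_ge0 x) (nm_ge0 a).
have h1 : 1 - nm x ^+ 2 <= e * m ^+ 2 by nra.
have h2 : (1 - nm x ^+ 2) * (1 - nm a ^+ 2) <= e * nm (x - a) ^+ 2.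
  have h3 : m ^+ 2 <= nm (x - a) ^+ 2 by rewrite ler_sqr ?nnegrE; lra.
  have h4 : 0 <= 1 - nm x ^+ 2 by nra.
  have h5 : (1 - nm x ^+ 2) * (1 - nm a ^+ 2) <= 1 - nm x ^+ 2.
    by rewrite ler_piMr // lerBlDr lerDl sqr_ge0.
  have h6 : e * m ^+ 2 <= e * nm (x - a) ^+ 2 by rewrite ler_pM2l.
  by lra.
have g2 : 0 <= nm (G0 x) ^+ 2 by exact: sqr_ge0.
have h3 := ler_wpM2l g2 (lerD (lexx (nm (x - a) ^+ 2)) h2).
apply: le_trans h3 _.
have h4 : (nm (x - a) * nm (G0 x)) ^+ 2 <= 1.
  by rewrite expr_le1 // mulr_ge0 // nm_ge0.
rewrite exprMn in h4; nra.
Qed.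

(** Allows the data to be shrunk strictly inside the disk, where Mobius maps have no poles. With
    [r^2 = 1 / (1 + e)] the shrunk form is a positive multiple of [X + e Y], and [e] tends to 0. *)
Lemma kpsd_scale_lim (I : eqType) (s : seq I) (w : I -> C) K :
  (forall r : R, 0 < r -> r < 1 ->
     kpsd s (fun i j => (1 - (r%:C * w i) * (r%:C * w j)^*) * K i j)) ->
  kpsd s (fun i j => (1 - w i * (w j)^*) * K i j).
Proof.
move=> H v; set X := hform _ _ _ _.
pose Y := hform s K v v.
have XY (e : R) : 0 < e -> 0 <= X + e%:C * Y.
  move=> e0; pose q := (1 + e)^-1.
  have q0 : 0 < q by rewrite invr_gt0; lra.
  have q1 : q < 1 by rewrite invf_lt1; lra.
  pose r := Num.sqrt q.
  have r0 : 0 < r by rewrite sqrtr_gt0.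
  have r2 : r ^+ 2 = q by rewrite sqr_sqrtr // ltW.
  have r1 : r < 1 by rewrite -(expr_lt1 (n := 2)) ?r2 // ltW.
  have := H r r0 r1 v.
  have -> : hform s (fun i j => (1 - (r%:C * w i) * (r%:C * w j)^*) * K i j) v v
     = q%:C * (X + e%:C * Y).
    rewrite -[e%:C * Y]hformZ -hformD -hformZ; apply: eq_hform => // i j _ _.
    rewrite rmorphM /= (conj_Creal (_ : r%:C \is Num.real)); last first.
      by rewrite ger0_real // ler0c ltW.
    have -> : e%:C = (q%:C)^-1 - 1 :> C.
      by rewrite -fmorphV -[1 in RHS](rmorph1 (real_complex R)) -rmorphB /q invrK addrC addKr.
    rewrite -r2 rmorphXn /=; field.
    by rewrite fmorph_eq0 gt_eqF.
  by rewrite pmulr_rge0 // ltcR.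
(* [Y] need not be real a priori; two values of [e] show that the imaginary part of [X] vanishes. *)
have X1 := XY 1 ltr01; have X2 := XY 2 (ltr0Sn R 1).
have I1 := ger0_Im X1; have I2 := ger0_Im X2.
have ReE (e : R) : complex.Re (X + e%:C * Y) = complex.Re X + e * complex.Re Y.
  by clear; case: X => a b; case: Y => a' b' /=; ring.
have ImE (e : R) : complex.Im (X + e%:C * Y) = complex.Im X + e * complex.Im Y.
  by clear; case: X => a b; case: Y => a' b' /=; ring.
rewrite !ImE in I1 I2.
rewrite lecE /=; apply/andP; split; first by apply/eqP; lra.
apply/ler_addgt0Pr => e e0.
pose t := e / (`|complex.Re Y| + 1).
have t0 : 0 < t by rewrite divr_gt0 // ltr_wpDl.
have := XY t t0; rewrite lecE ReE /= => /andP[_ h].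
apply: le_trans h _; rewrite lerD2l.
apply: le_trans (ler_norm _) _; rewrite normrM (gtr0_norm t0) /t.
rewrite mulrAC ler_pdivrMr ?ltr_wpDl // ler_pM2l //; lra.
Qed.

Lemma peano_mobius g (t : C) c : peano g c -> nm t < 1 -> nm (g c) < 1 ->
  peano (fun x => (g x - t) / (1 - t^* * g x)) c.
Proof.
move=> gp t1 g1; apply: peanoM; first exact: peanoB gp (peano_cst _ _).
apply: peanoV; last exact: disk_sub_conj_neq0.
apply: peanoB (peano_cst _ _) _; exact: peanoM (peano_cst _ _) gp.
Qed.

Lemma mobius_nm (t y : C) : nm t < 1 -> nm y < 1 -> nm ((y - t) / (1 - t^* * y)) <= 1.
Proof.
move=> t1 y1; rewrite nmM nmV ler_pdivrMr ?mul1r; last first.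
  by rewrite lt_def nm_eq0 nm_ge0 disk_sub_conj_neq0.
rewrite -lecR -!normE blaschke_norm ?norm_lt1 ?norm_le1 //; exact: ltW.
Qed.

(** Induction on the nodes, for all [f] at once: after shrinking, the Mobius image of [f] vanishing
    at the first node is a Blaschke factor times some [G], and [kpsd_pick_up] carries positivity
    from [G] back to [f]. *)
Lemma pick_necessary (I : eqType) (s : seq I) (z : I -> C) f :
  (forall i, nm (z i) < 1) ->
  (forall c, nm c < 1 -> peano f c) -> (forall x, nm x < 1 -> nm (f x) <= 1) ->
  kpsd s (pick_kernel z (f \o z)).
Proof.
move=> zD; elim: s f => [|i0 s IH] f fp f1.
  by move=> v; rewrite /hform big_nil.
apply: kpsd_scale_lim => r r0 r1.
pose g x := r%:C * f x; pose t := g (z i0).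
have g1 x : nm x < 1 -> nm (g x) < 1.
  move=> /f1; rewrite nmM nmR gtr0_norm //; have := nm_ge0 (f x); nra.
have t1 : nm t < 1 by exact: g1.
have gp c : nm c < 1 -> peano g c by move=> c1; apply: peanoM (peano_cst _ _) (fp c c1).
pose F x := (g x - t) / (1 - t^* * g x).
have Fp c : nm c < 1 -> peano F c by move=> c1; apply: peano_mobius (gp _ c1) t1 (g1 _ c1).
have F1 x : nm x < 1 -> nm (F x) <= 1 by move=> x1; exact: mobius_nm t1 (g1 _ x1).
have F0 : F (z i0) = 0 by rewrite /F subrr mul0r.
have [G [Gp G1 FE]] := schwarz_div Fp F1 (zD i0) F0.
have Gk := IH G Gp G1.
have := @kpsd_pick_up _ _ s z (G \o z) t i0 _ _ _ Gk.
rewrite norm_lt1 => /(_ _ t1) up; apply: eq_kpsd (up _ _) => [i j _ _|i|i] /=.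
- rewrite /pick_kernel /= -!FE //.
  suff e k : (F (z k) + t) / (1 + t^* * F (z k)) = g (z k) by rewrite !e.
  have d1 := disk_sub_conj_neq0 t1 (g1 _ (zD k)); have d2 := disk_sub_conj_neq0 t1 t1.
  have -> : 1 + t^* * F (z k) = (1 - t^* * t) / (1 - t^* * g (z k)).
    by rewrite /F; field.
  by rewrite /F; field; apply/andP; split.
- by rewrite norm_lt1.
- by rewrite norm_le1 G1.
Qed.

Lemma constrained_necessary (I : eqType) (s : seq I) (z : I -> C) f (alpha beta : C) :
  (forall i, nm (z i) < 1) ->
  (forall c, nm c < 1 -> peano f c) -> (forall x, nm x < 1 -> nm (f x) <= 1) ->
  bigO0 2 (fun h => f h - f 0) -> `|alpha| ^+ 2 + `|beta| ^+ 2 = 1 ->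
  kpsd s (fun i j => (1 - f (z i) * (f (z j))^*) * Kab alpha beta (z i) (z j)).
Proof.
move=> zD fp f1 f2 ab; apply: kpsd_scale_lim => r r0 r1.
pose g x := r%:C * f x; pose t := g 0.
have D0 : nm (0 : C) < 1 by rewrite nm0 ltr01.
have g1 x : nm x < 1 -> nm (g x) < 1.
  move=> /f1; rewrite nmM nmR gtr0_norm //; have := nm_ge0 (f x); nra.
have t1 : nm t < 1 by exact: g1.
have gp c : nm c < 1 -> peano g c by move=> c1; apply: peanoM (peano_cst _ _) (fp c c1).
pose F x := (g x - t) / (1 - t^* * g x).
have Fp c : nm c < 1 -> peano F c by move=> c1; apply: peano_mobius (gp _ c1) t1 (g1 _ c1).
have F1 x : nm x < 1 -> nm (F x) <= 1 by move=> x1; exact: mobius_nm t1 (g1 _ x1).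
have F0 : F 0 = 0 by rewrite /F subrr mul0r.
(* The second order contact of [f] with [f 0] becomes a double zero of [F], so the Schwarz lemma
   applies twice at 0. *)
have F2 : bigO0 2 F.
  have ip : peano (fun x => (1 - t^* * g x)^-1) 0.
    apply: (@peanoV _ (fun x => 1 - t^* * g x)); last exact: disk_sub_conj_neq0.
    apply: peanoB (peano_cst _ _) _; exact: peanoM (peano_cst _ _) (gp _ D0).
  have := bigO0M (bigO0M (bigO0_cst r%:C) f2) (peano_bounded ip).
  rewrite addn0 add0n; apply: eq_bigO0 ltr01 _ => h _.
  by rewrite /F /t /g add0r; ring.
have [G1 [G1p G11 FE1]] := schwarz_div Fp F1 D0 F0.
have {}FE1 x : nm x < 1 -> F x = x * G1 x.
  by move=> /FE1 ->; rewrite conjC0 mul0r !subr0 divr1.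
have G10 : G1 0 = 0.
  apply: bigO0_deriv_unique.
  have := bigO0D F2 (bigO0N (bigO0M (bigO0_id R) (peano_continuous (G1p _ D0)))).
  apply: eq_bigO0 ltr01 _ => h h1 /=; rewrite add0r FE1 // mul0r; ring.
have [G [Gp G1' FE2]] := schwarz_div G1p G11 D0 G10.
have FE x : nm x < 1 -> F x = x ^+ 2 * G x.
  move=> x1; rewrite FE1 // FE2 // conjC0 mul0r !subr0 divr1; ring.
have Gk := pick_necessary s zD Gp G1'.
(* The coefficient vectors of [e] and [e'] form an orthonormal basis, whence
   [e e^* + e' e'^* = 1 + z z^*]. *)
pose e i := alpha + beta * z i; pose e' i := - beta^* + alpha^* * z i.
have c0 : 0 <= (1 - t * t^*)^-1.
  by rewrite invr_ge0 -normCK subr_ge0 expr_le1 // norm_le1 ltW.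
have L := kpsdD (kpsd_rank1 s e) (kpsd_congr (fun i => z i ^+ 2)
  (kpsdD Gk (kpsd_congr (G \o z) (kpsd_rank1 s e')))).
have := kpsdZ c0 (kpsd_congr (fun i => 1 - t^* * g (z i)) L).
apply: eq_kpsd => i j _ _ /=.
have d1 k := disk_sub_conj_neq0 t1 (g1 _ (zD k)); have d2 := disk_sub_conj_neq0 t1 t1.
rewrite -/(g (z i)) -/(g (z j)).
have gE k : g (z k) = (z k ^+ 2 * G (z k) + t) / (1 + t^* * (z k ^+ 2 * G (z k))).
  rewrite -FE //.
  have -> : 1 + t^* * F (z k) = (1 - t^* * t) / (1 - t^* * g (z k)).
    by rewrite /F; field.
  by rewrite /F; field; apply/andP; split.
have d3 k : 1 + t^* * (z k ^+ 2 * G (z k)) != 0.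
  rewrite -FE //.
  have -> : 1 + t^* * F (z k) = (1 - t^* * t) / (1 - t^* * g (z k)).
    by rewrite /F; field.
  by rewrite mulf_neq0 // invr_eq0.
clearbody t.
have d4 k : 1 + t * ((z k)^* ^+ 2 * (G (z k))^*) != 0.
  by have := d3 k; rewrite -conjC_eq0 !(rmorphXn, rmorphD, rmorphM) /= conjCK conjC1.
have d5 : 1 - z i * (z j)^* != 0.
  by rewrite mulrC disk_sub_conj_neq0.
have d6 : 1 - t * t^* != 0 by rewrite mulrC.
have ba : beta * beta^* = 1 - alpha * alpha^*.
  by move: ab; rewrite !normCK => <-; ring.
have ee : e' i * (e' j)^* = 1 + z i * (z j)^* - e i * (e j)^*.
  apply/eqP; rewrite -subr_eq0.
  have -> : e' i * (e' j)^* - (1 + z i * (z j)^* - e i * (e j)^*) =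
    (beta * beta^* - (1 - alpha * alpha^*)) * (1 + z i * (z j)^*).
    by rewrite /e /e' !(rmorphB, rmorphD, rmorphN, rmorphM) /= !conjCK; ring.
  by rewrite ba subrr mul0r.
rewrite ee (gE i) (gE j) /pick_kernel /Kab /= -/(e i) -/(e j).
rewrite !(rmorphXn, rmorphB, rmorphD, fmorphV, rmorphM) /= !conjCK !conjC1.
by field; do ?[apply/andP; split]; first [exact: d5 | exact: d4 | exact: d3 | exact: d6 | exact: d2].
Qed.

End MaximumPrinciple.

(** * Rational functions are analytic *)

Section RationalAnalytic.
Variable R : realType.
Local Notation C := (Cplx R).
Implicit Types (f g : C -> C) (c : C) (p q : {poly C}).

Definition nmcvg (u : nat -> C) (l : C) := forall e : R, 0 < e ->
  exists n0, forall n, (n0 <= n)%N -> nm (u n - l) < e.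

Lemma nmcvgP (u : nat -> C) (l : C) : nmcvg u l -> u @ \oo --> l.
Proof.
move=> ul; apply/cvgrPdist_lt => e e0.
have eR : e = (complex.Re e)%:C by rewrite RRe_real // gtr0_real.
have e2 : 0 < complex.Re e by rewrite -ltcR -eR.
have [n0 H] := ul _ e2; exists n0 => // n /= nn.
by rewrite distrC eR normE ltcR H.
Qed.

(* The growth bound [M * L ^+ k] on the coefficients is what survives a
   division by ['X - b%:P]. *)
Definition power_series_at c f := exists (a : nat -> C) (M L r : R),
  [/\ 0 <= M, 0 < L, 0 < r, forall k, nm (a k) <= M * L ^+ k &
      forall h, nm h < r -> nmcvg (fun n => \sum_(k < n) a k * h ^+ k) (f (c + h))].

Lemma power_series_poly p c : power_series_at c (horner p).
Proof.
pose q := p \Po ('X + c%:P).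
have qE h : q.[h] = p.[c + h] by rewrite horner_comp !hornerE addrC.
exists (fun k => q`_k), (\sum_(i < size q) nm q`_i), 1, 1; split=> //.
- by rewrite sumr_ge0 // => i _; exact: nm_ge0.
- move=> k; rewrite expr1n mulr1; have [kq|kq] := ltnP k (size q).
    rewrite (bigD1 (Ordinal kq)) //= lerDl sumr_ge0 // => i _; exact: nm_ge0.
  by rewrite nth_default // nm0 sumr_ge0 // => i _; exact: nm_ge0.
- move=> h _ e e0; exists (size q) => n nq; rewrite -qE (horner_coef_wide _ nq).
  by rewrite subrr nm0.
Qed.

(** With [d = b - c], the coefficients of the quotient solve [(h - d) * sum = f (c + h)]
    recursively. *)
Lemma power_series_div_linear f c b : b != c ->
  power_series_at c f -> power_series_at c (fun x => f x / (x - b)).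
Proof.
move=> bc [a [M [L [r [M0 L0 r0 aL H]]]]].
pose d := b - c; have d0 : d != 0 by rewrite subr_eq0.
have nd : 0 < nm d by rewrite lt_def nm_eq0 d0 nm_ge0.
(* The coefficients shifted by one: [E k.+1] is the [k]-th one, and [E 0 = 0] starts the
   recursion. *)
pose E := fix E n : C := if n is k.+1 then (E k - a k) / d else 0.
(* The recursion at most doubles [M L'^k] before dividing by [|d|], and [L' >= 2 / |d|] absorbs
   this. *)
pose L' := Num.max L (2 / nm d).
have LL : L <= L' by rewrite le_max lexx.
have L'0 : 0 < L' by rewrite lt_max L0.
have L'd : 2 <= nm d * L' by rewrite mulrC -ler_pdivrMr // le_max lexx orbT.
have EL k : nm (E k) <= M * L' ^+ k.
  elim: k => [|k IH]; first by rewrite nm0 mulr_ge0.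
  rewrite /= nmM nmV ler_pdivrMr //.
  have h1 := nmD (E k) (- a k); rewrite nmN in h1.
  have h2 : M * L ^+ k <= M * L' ^+ k.
    by rewrite ler_wpM2l // lerXn2r ?nnegrE // ltW.
  have h3 := aL k; have h4 : 0 <= M * L' ^+ k by rewrite mulr_ge0 // exprn_ge0 // ltW.
  have -> : M * L' ^+ k.+1 * nm d = M * L' ^+ k * (nm d * L') by rewrite exprSr; ring.
  have h5 := ler_wpM2l h4 L'd; lra.
exists (fun k => E k.+1), (M * L'), L', (Num.min r (Num.min (1 / (2 * L')) (nm d))).
have half : 0 < 1 / (2 * L') by rewrite divr_gt0 // mulr_gt0.
split=> //.
- by rewrite mulr_ge0 // ltW.
- by rewrite !lt_min r0 half.
- by move=> k; rewrite -mulrA -exprS; exact: EL.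
move=> h; rewrite !lt_min => /and3P[hr hL hd] e e0.
have hd0 : h - d != 0.
  by rewrite subr_eq0; apply/eqP => hE; rewrite hE ltxx in hd.
have nhd : 0 < nm (h - d) by rewrite lt_def nm_eq0 hd0 nm_ge0.
(* The product telescopes; the leftover [E n h^n] tends to 0 because [|h| L' <= 1/2]. *)
have key n : (h - d) * (\sum_(k < n) E k.+1 * h ^+ k) =
    \sum_(k < n) a k * h ^+ k + E n * h ^+ n.
  elim: n => [|n IH]; first by rewrite !big_ord0 /= mul0r mulr0 addr0.
  rewrite !big_ord_recr /= mulrDr IH exprS; field.
  by [].
pose e' := e * nm (h - d) / 2; have e'0 : 0 < e' by rewrite divr_gt0 // mulr_gt0.
have [n0 n0P] := H h hr e' e'0.
have [n1 n1P] : exists n1, forall n, (n1 <= n)%N -> M * (1 / 2) ^+ n < e'.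
  have /cvgrPdist_lt /(_ e' e'0) [n1 _ n1P] := @cvg_geometric R M (1 / 2)
    ltac:(by rewrite ger0_norm; lra).
  exists n1 => n /n1P /=; rewrite sub0r normrN ger0_norm // mulr_ge0 // exprn_ge0 //; lra.
exists (maxn n0 n1) => n; rewrite geq_max => /andP[nn0 nn1].
have -> : \sum_(k < n) E k.+1 * h ^+ k - f (c + h) / (c + h - b) =
  (\sum_(k < n) a k * h ^+ k - f (c + h) + E n * h ^+ n) / (h - d).
  have -> : c + h - b = h - d by rewrite /d; ring.
  apply: (canRL (mulfK hd0)); rewrite mulrC mulrBr key; field.
  by [].
rewrite nmM nmV ltr_pdivrMr //.
apply: le_lt_trans (nmD _ _) _; rewrite nmM nmX.
have h1 := n0P n nn0; have h2 := n1P n nn1.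
have h3 : nm (E n) * nm h ^+ n <= M * (1 / 2) ^+ n.
  have h4 : nm h * L' <= 1 / 2.
    rewrite ltr_pdivlMr in hL; last by rewrite mulr_gt0.
    by lra.
  have h5 : (nm h * L') ^+ n <= (1 / 2) ^+ n.
    by rewrite lerXn2r ?nnegrE //; rewrite ?mulr_ge0 ?nm_ge0 ?(ltW L'0) //; lra.
  have h6 : nm (E n) * nm h ^+ n <= M * L' ^+ n * nm h ^+ n.
    by rewrite ler_wpM2r // exprn_ge0 // nm_ge0.
  apply: le_trans h6 _; rewrite -mulrA -exprMn [L' * _]mulrC; exact: ler_wpM2l.
by rewrite /e' in h1 h2; lra.
Qed.

Lemma eq_power_series_at c f g : f =1 g -> power_series_at c f -> power_series_at c g.
Proof.
move=> fg [a [M [L [r [M0 L0 r0 aL H]]]]]; exists a, M, L, r; split=> // h hr.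
by rewrite -fg; exact: H.
Qed.

(** The denominator splits into linear factors, which are divided out one by one. *)
Lemma power_series_rational p q c :
  q.[c] != 0 -> power_series_at c (fun x => p.[x] / q.[x]).
Proof.
have [s qE] := closed_field_poly_normal q; rewrite qE hornerZ.
rewrite mulf_eq0 negb_or => /andP[l0 cs].
have : power_series_at c (fun x => p.[x] / (\prod_(z <- s) ('X - z%:P)).[x]).
  elim: s cs {qE} => [|b s IH].
    rewrite big_nil => _; apply: eq_power_series_at (power_series_poly p c) => x.
    by rewrite hornerC divr1.
  rewrite big_cons hornerM mulf_eq0 negb_or => /andP[cb /IH ps].
  have bc : b != c by move: cb; rewrite !hornerE subr_eq0 eq_sym.
  apply: eq_power_series_at (power_series_div_linear bc ps) => x.
  by rewrite hornerM !hornerE invfM; ring.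
move=> [a [M [L [r [M0 L0 r0 aL H]]]]].
set l := lead_coef q in l0 *; have nl : 0 < nm l by rewrite lt_def nm_eq0 l0 nm_ge0.
exists (fun k => l^-1 * a k), ((nm l)^-1 * M), L, r; split=> //.
- by rewrite mulr_ge0 // invr_ge0 ltW.
- by move=> k; rewrite nmM nmV -mulrA ler_pM2l ?invr_gt0.
move=> h hr e e0; have [n0 n0P] := H h hr (e * nm l) (mulr_gt0 e0 nl).
exists n0 => n /n0P hn; rewrite hornerZ invfM mulrCA.
rewrite (eq_bigr (fun k : 'I_n => l^-1 * (a k * h ^+ k))) => [|k _]; last by rewrite mulrA.
by rewrite -mulr_sumr -mulrBr nmM nmV mulrC ltr_pdivrMr.
Qed.

Lemma analytic_rational (U : set C) p q :
  (forall c, U c -> q.[c] != 0) -> analytic_on U (fun x => p.[x] / q.[x]).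
Proof.
move=> q0 c Uc; have [a [M [L [r [M0 L0 r0 aL H]]]]] := power_series_rational p (q0 c Uc).
exists a; apply/nearC_nm; exists r => // y yr; apply: nmcvgP => e e0.
have [n0 n0P] := H (y - c) yr e e0; exists n0 => n /n0P.
by rewrite /series /= big_mkord [c + _]addrC subrK.
Qed.

Lemma derive1_bigO0 f (a : C) : bigO0 2 (fun h => f h - (f 0 + a * h)) -> f^`() 0 = a.
Proof.
move=> [M [r [M0 r0 H]]]; rewrite /derive1; apply/cvg_lim => //.
apply/cvgrPdist_lt => e e0.
have eR : e = (complex.Re e)%:C by rewrite RRe_real // gtr0_real.
have e2 : 0 < complex.Re e by rewrite -ltcR -eR.
have : \forall h \near 0, h != 0 -> `|a - h^-1 *: (f (h + 0) - f 0)| < e.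
  apply/nearC_nm; exists (Num.min r (complex.Re e / (M + 1))).
    by rewrite lt_min r0 divr_gt0 //; lra.
  move=> h; rewrite subr0 lt_min => /andP[h1 h2] h0.
  have nh : 0 < nm h by rewrite lt_def nm_eq0 h0 nm_ge0.
  rewrite addr0 eR normE ltcR nm_distC.
  have -> : h^-1 *: (f h - f 0) - a = (f h - (f 0 + a * h)) / h.
    by rewrite /GRing.scale /=; field.
  rewrite nmM nmV ltr_pdivrMr //; apply: le_lt_trans (H h h1) _.
  rewrite expr2 mulrA ltr_pM2r //; rewrite ltr_pdivlMr in h2; last by lra.
  by have := nm_ge0 h; nra.
exact.
Qed.

End RationalAnalytic.

(** * Quadratic forms and the Toeplitz-Hausdorff rotation *)

Section Peel.
Variables (R : realType) (T : eqType) (V : zmodType).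
Variables (P : T -> Prop) (m : T -> R) (F : T -> V).
Hypothesis rot : forall u v, P u -> P v -> m u * m v < 0 ->
  exists x y, [/\ P x, P y, m x = 0, m x + m y = m u + m v & F x + F y = F u + F v].

(** While the head is not a zero of [m], some other element has the opposite sign; [rot] trades the
    two for a zero of [m] and a remainder, and the list left to treat is shorter. [P] is an
    invariant and [F] records the sums to be preserved. *)
Lemma peel_zeros (l : seq T) :
  (forall u, u \in l -> P u) -> \sum_(u <- l) m u = 0 ->
  exists l', [/\ forall u, u \in l' -> P u, forall u, u \in l' -> m u = 0 &
    \sum_(u <- l') F u = \sum_(u <- l) F u].
Proof.
have [n] := ubnP (size l); elim: n l => // n IH [|u l].
  by exists [::].
move=> /= ln Pl; rewrite big_cons => ml.
have Pu : P u by apply: Pl; rewrite mem_head.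
have {}Pl v : v \in l -> P v by move=> vl; apply: Pl; rewrite inE vl orbT.
have [mu|mu] := eqVneq (m u) 0.
  have [||l' [Pl' ml' Fl']] := IH l _ Pl => //; first by rewrite mu add0r in ml.
  by exists (u :: l'); split=> [v|v|];
    rewrite ?inE ?big_cons ?Fl' // => /orP[/eqP ->//|]; [exact: Pl' | exact: ml'].
(* Otherwise [m u] times the sum of the others is nonnegative, whereas it equals [- (m u)^2]. *)
have [v vl uv] : exists2 v, v \in l & m u * m v < 0.
  apply/hasP/negPn/negP; rewrite -all_predC => /allP h.
  have : 0 <= \sum_(v <- l) m u * m v.
    by rewrite big_seq sumr_ge0 // => v /h /=; rewrite -leNgt.
  rewrite -mulr_sumr; have -> : \sum_(v <- l) m v = - m u by lra.
  by have := mu; rewrite -sqrf_eq0 => s0; have := sqr_ge0 (m u); rewrite le_eqVlt eq_sym (negPf s0) /=; lra.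
have [x [y [Px Py mx mxy Fxy]]] := rot Pu (Pl v vl) uv.
have pl := perm_to_rem vl.
have sl : (size (y :: rem v l) < n)%N.
  by rewrite /= size_rem // prednK //; case: (l) vl.
have Pl' w : w \in y :: rem v l -> P w.
  by rewrite inE => /orP[/eqP -> //|/mem_rem/Pl].
have sum0 : \sum_(w <- y :: rem v l) m w = 0.
  by move: ml; rewrite big_cons (perm_big _ pl) /= big_cons; lra.
have [l' [{}Pl' ml' Fl']] := IH _ sl Pl' sum0.
exists (x :: l'); split=> [w|w|].
- by rewrite inE => /orP[/eqP -> //|/Pl'].
- by rewrite inE => /orP[/eqP -> //|/ml'].
by rewrite big_cons Fl' !big_cons addrA Fxy (perm_big _ pl) /= big_cons addrA.
Qed.

End Peel.

Section Minimax.
Variables (R : realType) (I : eqType) (s : seq I).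
Local Notation C := (Cplx R).
Implicit Types (K : I -> I -> C) (u v : I -> C) (t : C).

Definition qform K v : R := complex.Re (hform s K v v).

Lemma hform_combo K (a b : C) u v :
  hform s K (fun i => a * u i + b * v i) (fun i => a * u i + b * v i) =
  (a^* * a) * hform s K u u + (b^* * b) * hform s K v v +
  (a^* * b * hform s K u v + b^* * a * hform s K v u).
Proof.
rewrite /hform !mulr_sumr -!big_split; apply: eq_bigr => i _ /=.
rewrite !mulr_sumr -!big_split; apply: eq_bigr => j _ /=.
by rewrite rmorphD !rmorphM /=; ring.
Qed.

Definition cross K (om : C) u v : R :=
  complex.Re (om * (hform s K u v + (hform s K v u)^*)).

Lemma conjE (x : C) : x^* = complex.Re x -i* complex.Im x.
Proof. by case: x. Qed.

Lemma conjR (a : R) : (a%:C : C)^* = a%:C.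
Proof. by rewrite conjE /= oppr0. Qed.

Lemma qform_rot K (a b : R) (om : C) u v : om^* * om = 1 ->
  qform K (fun i => a%:C * u i + (b%:C * om) * v i) =
  a ^+ 2 * qform K u + b ^+ 2 * qform K v + a * b * cross K om u v.
Proof.
move=> om1; rewrite /qform hform_combo rmorphM /= !conjR.
have -> : b%:C * om^* * (b%:C * om) = b%:C * b%:C by rewrite mulrACA om1 mulr1.
rewrite /cross !conjE.
move: (hform s K u u) (hform s K v v) (hform s K u v) (hform s K v u) => x y z w.
by case: x y z w om om1 => [x x'] [y y'] [z z'] [w w'] [c c'] _ /=; ring.
Qed.

(** As [f g < 0], the polynomial [f r^2 + X r + g] has a real root; [(a, b)] is [(r, 1)]
    normalised. *)
Lemma rotation_zero (f g X : R) : f * g < 0 ->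
  exists a b : R, a ^+ 2 + b ^+ 2 = 1 /\ a ^+ 2 * f + b ^+ 2 * g + a * b * X = 0.
Proof.
move=> fg.
have f0 : f != 0 by apply/eqP => f0; rewrite f0 mul0r ltxx in fg.
pose d := X ^+ 2 - 4 * f * g.
have d0 : 0 <= d by rewrite /d; have := sqr_ge0 X; lra.
pose r := (- X + Num.sqrt d) / (2 * f).
have root : r ^+ 2 * f + g + r * X = 0.
  have e := sqr_sqrtr d0; rewrite /r; move: e; set q := Num.sqrt d => e.
  have -> : g = (X ^+ 2 - q ^+ 2) / (4 * f) by rewrite e /d; field.
  by field.
clearbody r; pose n := Num.sqrt (r ^+ 2 + 1).
have n0 : 0 < r ^+ 2 + 1 by rewrite ltr_wpDl ?sqr_ge0.
have nn : n ^+ 2 = r ^+ 2 + 1 by rewrite sqr_sqrtr // ltW.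
have n1 : n != 0 by rewrite gt_eqF // sqrtr_gt0.
clearbody n; exists (r / n), (1 / n); split.
  by rewrite !expr_div_n expr1n nn; field; rewrite gt_eqF.
have -> : (r / n) ^+ 2 * f + (1 / n) ^+ 2 * g + r / n * (1 / n) * X =
  (r ^+ 2 * f + g + r * X) / n ^+ 2 by field.
by rewrite root mul0r.
Qed.

Lemma phase_zero (k : C) : exists2 om : C, om^* * om = 1 & complex.Re (om * k) = 0.
Proof.
have [->|k0] := eqVneq k 0; first by exists 1; rewrite ?conjC1 ?mulr1 ?mulr0.
have nk : nm k != 0 by rewrite nm_eq0.
exists ('i%C * k^* * ((nm k)^-1)%:C).
  rewrite !rmorphM /= conjR conjCK.
  have -> : ('i%C : C)^* = - 'i%C by rewrite conjE /=; apply/eqP; rewrite eq_complex /= oppr0 !eqxx.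
  have -> : - 'i%C * k * ((nm k)^-1)%:C * ('i%C * k^* * ((nm k)^-1)%:C) =
    - ('i%C ^+ 2) * (k * k^*) * (((nm k)^-1)%:C) ^+ 2 :> C by ring.
  rewrite sqr_i -normCK normE -mulrA -exprMn -rmorphM /= divff // rmorph1 expr1n.
  by rewrite opprK mulr1.
have -> : 'i%C * k^* * ((nm k)^-1)%:C * k = 'i%C * (nm k)%:C.
  transitivity ('i%C * (k * k^* * ((nm k)^-1)%:C) : C); first by ring.
  by rewrite -normCK normE expr2 -[_ * _ * _%:C]mulrA -rmorphM divff // rmorph1 mulr1.
by rewrite /= !mul0r mulr0 subrr.
Qed.

Lemma qform_rot2 K (a b : R) (om : C) u v : om^* * om = 1 ->
  qform K (fun i => (- b)%:C * u i + (a%:C * om) * v i) =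
  b ^+ 2 * qform K u + a ^+ 2 * qform K v - a * b * cross K om u v.
Proof. by move=> om1; rewrite qform_rot //; ring. Qed.

(* The rotation step in the proof of the Toeplitz-Hausdorff theorem: a unitary
   mixing of [u] and [v] preserves the sum of every quadratic form, and the
   phase [om] keeps a form vanishing at both vectors equal to zero. *)
Lemma qform_rotation K1 K2 u v : qform K2 u * qform K2 v < 0 ->
  exists x y, [/\ qform K2 x = 0,
   forall K, qform K x + qform K y = qform K u + qform K v &
   qform K1 u = 0 -> qform K1 v = 0 -> qform K1 x = 0 /\ qform K1 y = 0].
Proof.
move=> uv; have [om om1 om0] := phase_zero (hform s K1 u v + (hform s K1 v u)^*).
have [a [b [ab ab0]]] := rotation_zero (cross K2 om u v) uv.
exists (fun i => a%:C * u i + (b%:C * om) * v i), (fun i => (- b)%:C * u i + (a%:C * om) * v i).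
split=> [|K|u0 v0].
- by rewrite qform_rot.
- rewrite qform_rot // qform_rot2 //.
  have -> : qform K u + qform K v = (a ^+ 2 + b ^+ 2) * (qform K u + qform K v).
    by rewrite ab mul1r.
  by ring.
by rewrite qform_rot // qform_rot2 // u0 v0 /cross om0 !mulr0 subr0 !addr0.
Qed.

Lemma qform_imaginary K v : qform (fun i j => - 'i%C * K i j) v = complex.Im (hform s K v v).
Proof. by rewrite /qform hformZ; case: (hform s K v v) => a b /=; ring. Qed.

(** The real and imaginary parts of [K] are two real forms with zero sum. Peeling is done for the
    real part, then for the imaginary part with the vanishing of the real part as invariant. The sum
    of [L] is preserved, so one of the final vectors has [L] positive. *)
Lemma toeplitz_hausdorff_extract K L (l : seq (I -> C)) :
  \sum_(u <- l) hform s K u u = 0 -> 0 < \sum_(u <- l) qform L u ->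
  exists u, hform s K u u = 0 /\ 0 < qform L u.
Proof.
move=> K0 Lpos; pose K' := fun i j => - 'i%C * K i j : C.
have S0 : \sum_(u <- l) qform K u = 0 by rewrite -(raddf_sum (@complex.Re R)) K0.
have S1 : \sum_(u <- l) qform K' u = 0.
  under eq_bigr do rewrite qform_imaginary.
  by rewrite -(raddf_sum (@complex.Im R)) K0.
have rot1 u v : True -> True -> qform K u * qform K v < 0 ->
  exists x y, [/\ True, True, qform K x = 0, qform K x + qform K y = qform K u + qform K v
   & (qform K' x, qform L x) + (qform K' y, qform L y) =
     (qform K' u, qform L u) + (qform K' v, qform L v)].
  move=> _ _ uv; have [x [y [x0 xy _]]] := qform_rotation K uv.
  by exists x, y; split=> //; exact: (congr2 pair (xy K') (xy L)).
have [l1 [_ z1 F1]] := peel_zeros (V := (R * R)%type) (P := fun=> True) rot1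
  (fun _ _ => Logic.I) S0.
have e1 : \sum_(u <- l1) qform K' u = 0.
  have := congr1 fst F1; rewrite !(raddf_sum fst) /= => ->; exact: S1.
have e2 : \sum_(u <- l1) qform L u = \sum_(u <- l) qform L u.
  by have := congr1 snd F1; rewrite !(raddf_sum snd).
have rot2 u v : qform K u = 0 -> qform K v = 0 -> qform K' u * qform K' v < 0 ->
  exists x y, [/\ qform K x = 0, qform K y = 0, qform K' x = 0,
    qform K' x + qform K' y = qform K' u + qform K' v &
    qform L x + qform L y = qform L u + qform L v].
  move=> u0 v0 uv; have [x [y [x0 xy xy0]]] := qform_rotation K uv.
  by exists x, y; have [] := xy0 u0 v0; split.
have [l2 [z2 z2' F2]] := peel_zeros (P := fun u => qform K u = 0) rot2 z1 e1.
have [/hasP[u ul Lu]|] := boolP (has (fun u => 0 < qform L u) l2).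
  exists u; split=> //; have := z2 u ul; have := z2' u ul.
  rewrite qform_imaginary /qform.
  by case: (hform s K u u) => a b /= -> ->.
rewrite -all_predC => /allP h; move: Lpos; rewrite -e2 -F2 ltNge big_seq sumr_le0 //.
by move=> u /h /=; rewrite -leNgt.
Qed.

End Minimax.

(** * A common point of a family of disks *)

Section Disks.
Variables (R : realType) (I : eqType) (s : seq I).
Local Notation C := (Cplx R).
Variables (al be ga : I -> I -> C).
Implicit Types (u v : I -> C) (t tau : C).

Lemma Re_le_nm (x : C) : `|complex.Re x| <= nm x.
Proof. by rewrite -lecR; exact: normc_ge_Re. Qed.

(** When the form of [al] at [v] is some [a > 0], the set where this is nonpositive is a closed disk
    centred at the form of [be] divided by [a], or empty. *)
Definition dform t v : R := nm t ^+ 2 * qform s al v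
  - 2 * complex.Re (t^* * hform s be v v) + qform s ga v.

Lemma dform_shift t tau v : dform (t + tau) v = dform t v
  + 2 * complex.Re (tau^* * (t * (qform s al v)%:C - hform s be v v))
  + nm tau ^+ 2 * qform s al v.
Proof.
rewrite /dform !nm_sqr !conjE.
by case: t tau (hform s be v v) => [a a'] [b b'] [c c'] /=; ring.
Qed.

Definition pospart (x : R) : R := Num.max x 0.

Lemma pospart_ge0 x : 0 <= pospart x. Proof. by rewrite le_max lexx orbT. Qed.

Lemma pospart_le x : x <= pospart x. Proof. by rewrite le_max lexx. Qed.

Lemma pospart_sqr x : pospart x * x = pospart x ^+ 2.
Proof. by rewrite /pospart; case: (lerP x 0) => _; rewrite ?mul0r ?expr2 ?mulr0. Qed.

(** The squared positive part has derivative [2 * pospart x], with a quadratic error: this replaces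
    differentiation of the penalty. *)
Lemma pospart_sqr_add x y :
  pospart (x + y) ^+ 2 <= pospart x ^+ 2 + 2 * pospart x * y + y ^+ 2.
Proof.
rewrite /pospart; case: (lerP x 0) => x0; case: (lerP (x + y) 0) => xy; try nra.
Qed.

Lemma pospart_lip x y : `|pospart x - pospart y| <= `|x - y|.
Proof.
rewrite /pospart; case: (lerP x 0) => x0; case: (lerP y 0) => y0;
by rewrite ler_norml; have := ler_norm (x - y); have := ler_norm (- (x - y));
  rewrite normrN; move: `|x - y| => n; lra.
Qed.

Lemma continuous_dform v : continuous (fun t : C => dform t v).
Proof.
move=> t; apply/(@cvgrPdist_lt _ _ _ (nbhs t) (nbhs_filter t)) => e e0.
pose g := t * (qform s al v)%:C - hform s be v v.
pose k := 2 * nm g + `|qform s al v| + 1.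
have [n1 n2] := conj (nm_ge0 g) (normr_ge0 (qform s al v)).
have k0 : 0 < k by rewrite /k; lra.
apply/nearC_nm; exists (Num.min 1 (e / k)); first by rewrite lt_min ltr01 divr_gt0.
move=> y; rewrite lt_min ltr_pdivlMr // => /andP[y1 y2].
have -> : dform y v = dform (t + (y - t)) v by rewrite addrC subrK.
rewrite dform_shift.
set tau := y - t in y1 y2 *.
have h1 := Re_le_nm (tau^* * g); rewrite nmM nm_conj in h1.
have h2 : `|nm tau ^+ 2 * qform s al v| <= nm tau * `|qform s al v|.
  rewrite normrM ger0_norm ?sqr_ge0 // ler_wpM2r // expr2 ler_piMr ?nm_ge0 //.
  exact: ltW.
rewrite -/g; set d := dform t v; set a := complex.Re _; set b := nm tau ^+ 2 * _.
have -> : d - (d + 2 * a + b) = - (2 * a + b) by ring.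
rewrite normrN; apply: le_lt_trans (ler_normD _ _) _; rewrite normrM gtr0_norm //.
rewrite -/a -/b in h1 h2; move: y2; rewrite /k; have := nm_ge0 tau; nra.
Qed.

Definition penalty (l : seq (I -> C)) t : R := \sum_(v <- l) pospart (dform t v) ^+ 2.

Lemma continuous_penalty l : continuous (penalty l : C -> R).
Proof.
move=> t; have FF := nbhs_filter t.
elim: l => [|v l IH].
  have -> : penalty [::] = fun=> 0 by apply/funext => x; rewrite /penalty big_nil.
  exact: cvg_cst.
have -> : penalty (v :: l) = fun x => pospart (dform x v) * pospart (dform x v) + penalty l x.
  by apply/funext => x; rewrite /penalty big_cons expr2.
have pc : pospart (dform x v) @[x --> t] --> pospart (dform t v).
  apply/(@cvgrPdist_lt _ _ _ (nbhs t) FF) => e e0.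
  have /(@cvgrPdist_lt _ _ _ (nbhs t) FF) /(_ e e0) := @continuous_dform v t.
  by apply: filterS => x; apply: le_lt_trans; exact: pospart_lip.
apply: (@cvgD _ _ _ (nbhs t) FF) => //; exact: (@cvgM _ _ (nbhs t) FF).
Qed.

Lemma dform_coercive v (M : R) : 0 < qform s al v ->
  exists2 rho : R, 0 < rho & forall t, rho <= nm t -> M <= dform t v.
Proof.
move=> A0; set a := qform s al v in A0.
pose b := nm (hform s be v v); pose g := qform s ga v.
pose k := 2 * b + `|g| + `|M|.
have b0 : 0 <= b by exact: nm_ge0.
have [g0 M0] := conj (normr_ge0 g) (normr_ge0 M).
exists (1 + k / a); first by rewrite ltr_pwDl // divr_ge0 ?(ltW A0) // /k; lra.
move=> t ht; rewrite /dform -/a -/g.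
have := Re_le_nm (t^* * hform s be v v); rewrite nmM nm_conj -/b.
set r := complex.Re _ => hr.
have ak : k <= a * nm t.
  rewrite mulrC -ler_pdivrMr //; lra.
have t1 : 1 <= nm t.
  apply: le_trans ht; rewrite lerDl divr_ge0 ?(ltW A0) // /k; lra.
have h1 : nm t * k <= nm t * (a * nm t) by rewrite ler_wpM2l // nm_ge0.
have h2 := ler_norm r; have h3 := ler_norm (- g); have h4 := ler_norm M.
rewrite normrN in h3.
have h5 : `|g| + `|M| <= nm t * (`|g| + `|M|) by rewrite ler_peMl // addr_ge0.
have h6 : nm t * k = 2 * (nm t * b) + nm t * (`|g| + `|M|) by rewrite /k; ring.
have h7 : nm t ^+ 2 * a = nm t * (a * nm t) by ring.
rewrite h7; lra.
Qed.

Lemma penalty_has_min l v : v \in l -> 0 < qform s al v ->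
  exists t0, forall t, penalty l t0 <= penalty l t.
Proof.
move=> vl A0.
have p0 t : 0 <= penalty l t by rewrite sumr_ge0 // => w _; exact: sqr_ge0.
(* The added 1 makes the square of the positive part exceed [penalty l 0] too, even if that value is
   below 1. *)
have [rho rho0 H] := dform_coercive (penalty l 0 + 1) A0.
have out t : rho <= nm t -> penalty l 0 <= penalty l t.
  move=> /H h; rewrite {2}/penalty (perm_big _ (perm_to_rem vl)) /= big_cons.
  have : penalty l 0 + 1 <= pospart (dform t v) by apply: le_trans h (pospart_le _).
  have : 0 <= \sum_(w <- rem v l) pospart (dform t w) ^+ 2.
    by rewrite sumr_ge0 // => w _; exact: sqr_ge0.
  have := p0 0; move: (penalty l 0) (pospart _) (\sum_(_ <- _) _) => x y z; nra.
have ct : {within [set x : C | nm x <= rho], continuous (penalty l)}.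
  by apply: continuous_subspaceT => x; exact: continuous_penalty.
have [|t0 t0r t0min] := compact_EVT_min _ (@compact_disk R rho) ct.
  by exists (0 : C); rewrite -(nm0 R) in rho0; exact: ltW.
exists t0 => t; have [tr|tr] := lerP (nm t) rho; first by apply: t0min; rewrite inE.
apply: le_trans (out t (ltW tr)); apply: t0min; rewrite inE; rewrite -(nm0 R) in rho0; exact: ltW.
Qed.

(** The sum [G] is a quarter of the gradient. A step [- e G] changes the penalty by at most
    [- 4 e |G|^2] plus a multiple of [e^2], so [G] vanishes at a minimiser. *)
Lemma penalty_critical l t0 : (forall t, penalty l t0 <= penalty l t) ->
  \sum_(v <- l) (pospart (dform t0 v))%:C *
     (t0 * (qform s al v)%:C - hform s be v v) = 0 :> C.
Proof.
move=> min; pose p v := pospart (dform t0 v).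
pose g v : C := t0 * (qform s al v)%:C - hform s be v v.
set G := \sum_(v <- l) _; have [N Nd] : exists N, N = nm G ^+ 2 by exists (nm G ^+ 2).
pose S1 := \sum_(v <- l) p v * qform s al v.
pose Y v := 2 * `|complex.Re (G^* * g v)| + N * `|qform s al v|.
pose S2 := \sum_(v <- l) Y v ^+ 2.
have NE : N = \sum_(v <- l) p v * complex.Re (G^* * g v).
  have -> : N = complex.Re (G^* * G) by rewrite Nd nm_sqr conjE; case: (G) => a b /=; ring.
  rewrite {2}/G mulr_sumr raddf_sum; apply: eq_bigr => v _ /=.
  rewrite -/(p v) -/(g v) conjE; case: (G) (g v) => a b [c d] /=; ring.
have N0 : 0 <= N by rewrite Nd sqr_ge0.
have key (e : R) : 0 < e -> e <= 1 -> 4 * N <= e * (2 * N * S1 + S2).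
  move=> e0 e1; have := min (t0 - e%:C * G).
  pose y v := - (2 * e * complex.Re (G^* * g v)) + e ^+ 2 * N * qform s al v.
  have yE v : dform (t0 - e%:C * G) v = dform t0 v + y v.
    rewrite dform_shift -/(g v) -addrA; congr (_ + _); rewrite /y Nd nmN nmM nmR gtr0_norm //.
    rewrite exprMn rmorphN rmorphM /= conjR; congr (_ + _).
    by rewrite !conjE; case: (G) (g v) => a b [c d] /=; ring.
  have yY v : y v ^+ 2 <= e ^+ 2 * Y v ^+ 2.
    rewrite -exprMn -[y v ^+ 2]real_normK ?num_real //.
    rewrite ler_sqr ?nnegrE ?normr_ge0 //; last first.
      by rewrite mulr_ge0 ?(ltW e0) // addr_ge0 // mulr_ge0.
    apply: le_trans (ler_normD _ _) _; rewrite normrN expr2 !normrM.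
    rewrite (gtr0_norm e0) (ger0_norm N0) /Y (ger0_norm (_ : 0 <= 2)) //.
    have := mulr_ge0 N0 (normr_ge0 (qform s al v)).
    move: `|complex.Re _| `|qform s al v| => x a Na.
    have : e * (e * (N * a)) <= 1 * (e * (N * a)).
      by rewrite ler_wpM2r // mulr_ge0 // ltW.
    by lra.
  have : penalty l (t0 - e%:C * G) <= penalty l t0 + (- (4 * e * N) + 2 * e ^+ 2 * N * S1 + e ^+ 2 * S2).
    have -> : - (4 * e * N) + 2 * e ^+ 2 * N * S1 + e ^+ 2 * S2 =
      \sum_(v <- l) (2 * p v * y v + e ^+ 2 * Y v ^+ 2).
      have pyE : \sum_(v <- l) p v * y v = - (2 * e) * N + e ^+ 2 * N * S1.
        rewrite {1}NE /S1 2!mulr_sumr -big_split /=; apply: eq_bigr => v _.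
        by rewrite /y; ring.
      rewrite big_split /= -mulr_sumr -/S2.
      rewrite (eq_bigr (fun v => 2 * (p v * y v))) => [|v _]; last by rewrite mulrA.
      by rewrite -mulr_sumr pyE; ring.
    rewrite /penalty -big_split /=; apply: ler_sum => v _; rewrite yE.
    apply: le_trans (pospart_sqr_add _ _) _; rewrite -addrA lerD2l lerD2l; exact: yY.
  move=> h1 h2; have {h1 h2} := le_trans h2 h1; rewrite lerDl => h.
  rewrite -(ler_pM2l e0); have -> : e * (e * (2 * N * S1 + S2)) = 2 * e ^+ 2 * N * S1 + e ^+ 2 * S2 by ring.
  have -> : e * (4 * N) = 4 * e * N by ring.
  lra.
have : N = 0.
  apply/eqP; rewrite eq_le N0 andbT leNgt; apply/negP => Npos.
  pose K := `|2 * N * S1 + S2| + 1.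
  have K0 : 0 < K by rewrite ltr_wpDl.
  pose e := Num.min 1 (N / K).
  have e0 : 0 < e by rewrite lt_min ltr01 divr_gt0.
  have e1 : e <= 1 by rewrite ge_min lexx.
  have eK : e * K <= N by rewrite -ler_pdivlMr // ge_min lexx orbT.
  have := key e e0 e1; have := ler_norm (2 * N * S1 + S2).
  by move: eK; rewrite /K; move: (2 * N * S1 + S2) `|_| => x x' h1 h2 h3; nra.
by move/eqP; rewrite Nd sqrf_eq0 nm_eq0 => /eqP.
Qed.

Hypothesis al_psd : kpsd s al.
Hypothesis pointwise : forall v, exists t, dform t v <= 0.

Lemma al_real v : hform s al v v = (qform s al v)%:C.
Proof. by have := al_psd v; rewrite /qform => /ger0_real /RRe_real. Qed.

Lemma hform_scale K (c : C) v :
  hform s K (fun i => c * v i) (fun i => c * v i) = c^* * c * hform s K v v.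
Proof.
rewrite /hform mulr_sumr; apply: eq_bigr => i _; rewrite mulr_sumr.
by apply: eq_bigr => j _; rewrite rmorphM /=; ring.
Qed.

Lemma disks_finite_intersection (l : seq (I -> C)) v0 : v0 \in l -> 0 < qform s al v0 ->
  exists t, forall v, v \in l -> dform t v <= 0.
Proof.
move=> v0l A0; have [t0 min] := penalty_has_min v0l A0.
have crit := penalty_critical min; exists t0.
have [p0|pn0] := eqVneq (penalty l t0) 0.
  move=> v vl; apply: le_trans (pospart_le _) _.
  have : pospart (dform t0 v) ^+ 2 <= 0.
    rewrite -p0 /penalty (perm_big _ (perm_to_rem vl)) /= big_cons lerDl.
    by apply: sumr_ge0 => w _; exact: sqr_ge0.
  by rewrite exprn_even_le0 //= => /eqP ->.
exfalso.
(* [K] is half the derivative of [dform] at [t0], and the real part of the form of [L] is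
   [dform t0]. *)
pose K i j := t0 * al i j - be i j.
pose L i j := (nm t0 ^+ 2)%:C * al i j + (- (2 * t0^*) * be i j + ga i j).
have KE v : hform s K v v = t0 * (qform s al v)%:C - hform s be v v.
  rewrite -al_real -hformZ -mulN1r -hformZ -hformD; apply: eq_hform => // i j _ _.
  by rewrite /K mulN1r.
have LE v : qform s L v = dform t0 v.
  rewrite /qform hformD hformD !hformZ al_real /dform /qform.
  rewrite !conjE; case: (t0) (hform s be v v) (hform s ga v v) => [a b] [c d] [e f] /=; ring.
(* Scaling by the square root of the weight turns the weighted critical equation into a plain sum of
   forms. *)
pose sc v i : C := (Num.sqrt (pospart (dform t0 v)))%:C * v i.
have scE K' v : hform s K' (sc v) (sc v) = (pospart (dform t0 v))%:C * hform s K' v v.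
  by rewrite hform_scale conjR -rmorphM -expr2 sqr_sqrtr ?pospart_ge0.
have [||u [Ku Lu]] := @toeplitz_hausdorff_extract R I s K L (map sc l).
- by rewrite big_map -[RHS]crit; apply: eq_bigr => v _; rewrite scE KE.
- rewrite big_map (eq_bigr (fun v => pospart (dform t0 v) ^+ 2)).
    rewrite lt_def pn0 /=; apply: sumr_ge0 => v _; exact: sqr_ge0.
  move=> v _; rewrite /qform scE -pospart_sqr -(LE v) /qform.
  by case: (hform s L v v) => a b /=; ring.
(* At [u] the linear term is gone, so [dform t u] is [dform t0 u] plus a nonnegative term: positive
   for every [t]. *)
have [t] := pointwise u; have -> : dform t u = dform (t0 + (t - t0)) u by rewrite addrC subrK.
rewrite dform_shift -KE Ku mulr0 mulr0 addr0.
rewrite leNgt; apply/negP; rewrite negbK; rewrite -LE in Lu *.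
rewrite ltr_wpDr // mulr_ge0 ?sqr_ge0 // -ler0c -al_real; exact: al_psd.
Qed.

End Disks.

(** The disk of [v0] is bounded, so the finite intersection property in a compact disk applies; [v0]
    is added to each finite family to keep its common point in there. *)
Lemma disks_intersection (R : realType) (I : eqType) (s : seq I)
    (al be ga : I -> I -> Cplx R) :
  kpsd s al -> (forall v, exists t, dform s al be ga t v <= 0) ->
  forall v0, 0 < qform s al v0 -> exists t, forall v, dform s al be ga t v <= 0.
Proof.
move=> alp pw v0 A0.
have [rho rho0 rhoP] := dform_coercive be ga 1 A0.
pose A := [set t : Cplx R | nm t <= rho].
pose T (v : I -> Cplx R) := [set t : Cplx R | dform s al be ga t v <= 0].
have cA : compact A := @compact_disk R rho.
rewrite compact_In0 in cA.
have [||t tP] := cA (I -> Cplx R) setT (fun v => A `&` T v).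
- exists T => // v _; apply: (@closed_comp _ _ (fun t => dform s al be ga t v) [set x : R | x <= 0]).
    by move=> t _; exact: continuous_dform.
  exact: closed_le.
- move=> D' _.
  have v0l : v0 \in v0 :: enum_fset D' by rewrite mem_head.
  have [t tP] := disks_finite_intersection alp pw v0l A0.
  exists t => v /= vD; split; last by apply: tP; rewrite inE vD orbT.
  rewrite /A /= leNgt; apply/negP => /ltW /rhoP; have := tP v0 v0l; lra.
by exists t => v; have [] := tP v Logic.I.
Qed.

(** * Determinant inequalities for Hermitian forms in two variables *)

Section Pencil.
Variable C : numClosedFieldType.
Implicit Types q a b : C.

(** The vector [(- conj(n), x)] gives [x (x y - |n|^2)]; if [x = 0] the roles are swapped, and if
    both vanish [(- conj(n), 1)] gives [- 2 |n|^2]. *)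
Lemma hermitian2_det (x y n : C) :
  (forall al be : C, 0 <= `|al| ^+ 2 * x + `|be| ^+ 2 * y + (al * be^* * n + (al * be^* * n)^*)) ->
  0 <= x * y - `|n| ^+ 2.
Proof.
move=> H.
have x0 : 0 <= x.
  by have := H 1 0; rewrite normr1 normr0 conjC0 mulr0 mul0r conjC0 !addr0 expr0n mul0r addr0 expr1n mul1r.
have y0 : 0 <= y.
  by have := H 0 1; rewrite normr1 normr0 !mul0r conjC0 !addr0 expr0n mul0r add0r expr1n mul1r.
have xr : x^* = x := conj_Creal (ger0_real x0).
have yr : y^* = y := conj_Creal (ger0_real y0).
have [xe|xn] := eqVneq x 0; last first.
  have := H (- n^*) x.
  have -> : `|- n^*| ^+ 2 * x + `|x| ^+ 2 * y + (- n^* * x^* * n + (- n^* * x^* * n)^*) =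
    x * (x * y - `|n| ^+ 2).
    by rewrite !normCK !(rmorphM, rmorphN) /= !conjCK !xr; ring.
  by rewrite pmulr_rge0 // lt_def xn.
have [ye|yn] := eqVneq y 0; last first.
  have := H y (- n).
  have -> : `|y| ^+ 2 * x + `|- n| ^+ 2 * y + (y * (- n)^* * n + (y * (- n)^* * n)^*) =
    y * (x * y - `|n| ^+ 2).
    by rewrite !normCK !(rmorphM, rmorphN) /= !conjCK !yr; ring.
  by rewrite pmulr_rge0 // lt_def yn.
have := H (- n^*) 1.
have -> : `|- n^*| ^+ 2 * x + `|1 : C| ^+ 2 * y + (- n^* * 1^* * n + (- n^* * 1^* * n)^*) =
    2 * (x * y - `|n| ^+ 2).
  by rewrite !normCK xe ye !(rmorphM, rmorphN) /= !conjCK !conjC1; ring.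
by rewrite pmulr_rge0.
Qed.

Lemma unit_form_scale q a1 a2 b1 b2 :
  (forall al be : C, `|al| ^+ 2 + `|be| ^+ 2 = 1 ->
     0 <= q + `|a1 * al + a2 * be| ^+ 2 - `|b1 * al + b2 * be| ^+ 2) ->
  forall al be : C, 0 <= q * (`|al| ^+ 2 + `|be| ^+ 2) + `|a1 * al + a2 * be| ^+ 2
     - `|b1 * al + b2 * be| ^+ 2.
Proof.
move=> H al be; set N := `|al| ^+ 2 + `|be| ^+ 2.
have N0 : 0 <= N by rewrite addr_ge0 ?exprn_ge0.
have [Ne|Nn] := eqVneq N 0.
  have [-> ->] : al = 0 /\ be = 0.
    by move/eqP: Ne; rewrite paddr_eq0 ?exprn_ge0 // !expf_eq0 /= !normr_eq0 => /andP[/eqP -> /eqP ->].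
  by rewrite Ne !mulr0 add0r subrr.
pose r := sqrtC N.
have r2 : r ^+ 2 = N by rewrite sqrtCK.
have rp : 0 < r by rewrite lt_def sqrtC_eq0 Nn sqrtC_ge0.
have r0 : r != 0 by rewrite gt_eqF.
have := H (al / r) (be / r).
rewrite !normf_div (gtr0_norm rp) !expr_div_n -mulrDl r2 divff // => /(_ erefl).
rewrite !mulrA -!mulrDl !normf_div (gtr0_norm rp) !expr_div_n r2.
rewrite -(pmulr_rge0 _ (_ : 0 < N)) ?lt_def ?Nn // => h; apply: le_trans h _.
by rewrite le_eqVlt; apply/orP; left; apply/eqP; field.
Qed.

(** The vector [(- a2, a1)] kills the first square and gives [q >= 0]; [A - G] is the trace of the
    form, and the last inequality is its determinant. *)
Lemma pencil_bounds q a1 a2 b1 b2 :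
  (forall al be : C, `|al| ^+ 2 + `|be| ^+ 2 = 1 ->
     0 <= q + `|a1 * al + a2 * be| ^+ 2 - `|b1 * al + b2 * be| ^+ 2) ->
  let A := q + (`|a1| ^+ 2 + `|a2| ^+ 2) in
  let G := (`|b1| ^+ 2 + `|b2| ^+ 2) - q in
  [/\ 0 <= q, G <= A & G * A <= `|b1 * a1^* + b2 * a2^*| ^+ 2].
Proof.
move=> /unit_form_scale H A G.
have q0 : 0 <= q.
  have [/eqP ae|an] := eqVneq (`|a1| ^+ 2 + `|a2| ^+ 2) 0.
    move: ae; rewrite paddr_eq0 ?exprn_ge0 // !expf_eq0 /= !normr_eq0 => /andP[/eqP a1e /eqP a2e].
    have := H 1 0; rewrite a1e a2e normr1 normr0 expr1n expr0n /= !addr0 !mulr0 mul0r !addr0 normr0 expr0n /= addr0 !mulr1.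
    rewrite subr_ge0; apply: le_trans; exact: exprn_ge0.
  have := H (- a2) a1; rewrite normrN [_ + `|a1| ^+ 2]addrC mulrN [a2 * _]mulrC addNr normr0 expr0n addr0.
  rewrite subr_ge0 => h; have : 0 <= q * (`|a1| ^+ 2 + `|a2| ^+ 2).
    by apply: le_trans h; rewrite exprn_ge0.
  by rewrite pmulr_lge0 // lt_def an addr_ge0 ?exprn_ge0.
have qr : q^* = q := conj_Creal (ger0_real q0).
split=> //.
  have := H 1 0; have := H 0 1.
  rewrite !normr1 !normr0 !expr1n !expr0n /= !mulr1 !mulr0 !addr0 !add0r !mulr1 => h1 h2.
  have := addr_ge0 h1 h2; rewrite -[G <= A]subr_ge0; congr (_ <= _); rewrite /A /G; ring.
have := @hermitian2_det (q + `|a1| ^+ 2 - `|b1| ^+ 2) (q + `|a2| ^+ 2 - `|b2| ^+ 2) (a1 * a2^* - b1 * b2^*).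
rewrite -[G * A <= _]subr_ge0 => D.
have -> : `|b1 * a1^* + b2 * a2^*| ^+ 2 - G * A =
   (q + `|a1| ^+ 2 - `|b1| ^+ 2) * (q + `|a2| ^+ 2 - `|b2| ^+ 2) - `|a1 * a2^* - b1 * b2^*| ^+ 2.
  by rewrite /A /G !normCK !(rmorphM, rmorphN, rmorphD) /= !conjCK; ring.
apply: D => al be; apply: le_trans (H al be) _.
rewrite le_eqVlt; apply/orP; left; apply/eqP.
by rewrite !normCK !(rmorphM, rmorphB, rmorphD) /= !conjCK; ring.
Qed.

End Pencil.

(** * The sufficient condition *)

Lemma kpsd_neq0_diag (R : realType) (I : eqType) (s : seq I) (K : I -> I -> Cplx R) i :
  uniq s -> i \in s -> 0 < K i i -> kpsd s K -> exists v, 0 < qform s K v.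
Proof.
move=> us si Ki Kp; apply: contrapT => /forallNP N.
have Kn : kpsd s (fun i j => -1 * K i j).
  move=> v; rewrite hformZ mulN1r oppr_ge0.
  have /ger0_real/RRe_real <- := Kp v; rewrite (lecR _ 0) leNgt.
  exact/negP/N.
by have := kpsd_diag us Kn si; rewrite mulN1r oppr_ge0 => /(lt_le_trans Ki); rewrite ltxx.
Qed.

Section Sufficiency.
Variables (R : realType) (I : eqType) (s : seq I).
Local Notation C := (Cplx R).
Variables (z w : I -> C).
Hypothesis s_uniq : uniq s.
Hypothesis zD : forall i, nm (z i) < 1.
Hypothesis hyp : forall alpha beta : C, `|alpha| ^+ 2 + `|beta| ^+ 2 = 1 ->
  kpsd s (fun i j => (1 - w i * (w j)^*) * Kab alpha beta (z i) (z j)).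

Let S i j : C := z i ^+ 2 * (z j)^* ^+ 2 / (1 - z i * (z j)^*).
Let kS i j : C := (1 - w i * (w j)^*) * S i j.
(** [al], [be] and [ga] are the coefficients in [t] of minus [dist_kernel t]; the factors [1^*]
    display the rank one kernels. *)
Let al i j : C := kS i j + (1 * 1^* + z i * (z j)^*).
Let be i j : C := w i * 1^* + w i * z i * (z j)^*.
Let ga i j : C := (w i * (w j)^* + w i * z i * (w j * z j)^*) + -1 * kS i j.

Let a1 v : C := \sum_(i <- s) (v i)^* * 1.
Let a2 v : C := \sum_(i <- s) (v i)^* * z i.
Let b1 v : C := \sum_(i <- s) (v i)^* * w i.
Let b2 v : C := \sum_(i <- s) (v i)^* * (w i * z i).

Let alE v : hform s al v v = hform s kS v v + (`|a1 v| ^+ 2 + `|a2 v| ^+ 2).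
Proof. by rewrite hformD hformD (hform_rank1 _ (fun=> 1) (fun=> 1)) hform_rank1 !normCK. Qed.

Let beE v : hform s be v v = b1 v * (a1 v)^* + b2 v * (a2 v)^*.
Proof. by rewrite hformD (hform_rank1 _ w (fun=> 1)) (hform_rank1 _ (fun i => w i * z i)). Qed.

Let gaE v : hform s ga v v = (`|b1 v| ^+ 2 + `|b2 v| ^+ 2) - hform s kS v v.
Proof.
by rewrite hformD hformD hformZ !hform_rank1 !normCK mulN1r.
Qed.

Let bounds v := @pencil_bounds C (hform s kS v v) (a1 v) (a2 v) (b1 v) (b2 v).

(** With [e = x + y z], the kernel in [hyp] is [kS + e e^* - (w e) (w e)^*], which has the shape
    required by [pencil_bounds]. *)
Let form_ge0 v (x y : C) : `|x| ^+ 2 + `|y| ^+ 2 = 1 ->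
  0 <= hform s kS v v + `|a1 v * x + a2 v * y| ^+ 2 - `|b1 v * x + b2 v * y| ^+ 2.
Proof.
move=> xy; have := hyp xy v; congr (_ <= _).
pose e i := x + y * z i.
rewrite (@eq_hform _ _ _ _ (fun i j => kS i j + (e i * (e j)^* + -1 * ((w i * e i) * (w j * e j)^*))) _ _ v v) //; last first.
  by move=> i j _ _; rewrite /Kab /kS /S -/(e i) -/(e j) rmorphM; ring.
rewrite hformD hformD hformZ hform_rank1 (hform_rank1 _ (fun i => w i * e i) (fun i => w i * e i)) -!normCK mulN1r addrA.
have -> : \sum_(i <- s) (v i)^* * e i = a1 v * x + a2 v * y.
  by rewrite /a1 /a2 !mulr_suml -big_split; apply: eq_bigr => i _ /=; rewrite /e; ring.
have -> // : \sum_(i <- s) (v i)^* * (w i * e i) = b1 v * x + b2 v * y.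
by rewrite /b1 /b2 !mulr_suml -big_split; apply: eq_bigr => i _ /=; rewrite /e; ring.
Qed.

Let al_psd : kpsd s al.
Proof.
move=> v; have [q0 _ _] := bounds (@form_ge0 v).
by rewrite alE !addr_ge0 // exprn_ge0.
Qed.

Let pointwise v : exists t, dform s al be ga t v <= 0.
Proof.
have [q0 GA BGA] := bounds (@form_ge0 v).
rewrite -alE -gaE -beE in GA BGA.
have Ar := al_real al_psd v; have A0 := al_psd v.
have Gr : hform s ga v v = (qform s ga v)%:C.
  have /RRe_real <- // : hform s ga v v \is Num.real.
  by rewrite gaE realB ?ger0_real ?addr_ge0 ?exprn_ge0.
rewrite Ar Gr lecR in GA; rewrite Ar (ler0c (qform s al v)) in A0.
rewrite Ar Gr normE -rmorphXn -rmorphM lecR in BGA.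
set a := qform s al v in GA BGA A0; set g := qform s ga v in GA BGA.
set b := hform s be v v in BGA.
have [ae|an] := eqVneq a 0.
  exists 0; rewrite /dform -/a -/g nm0 expr0n mul0r conjC0 mul0r /= mulr0 subr0 add0r.
  by rewrite -ae.
have ap : 0 < a by rewrite lt_def an.
(* The centre of the disk, where [dform] is [g - |b|^2 / a]. *)
exists (b * (a^-1)%:C); rewrite /dform -/a -/b -/g.
have -> : complex.Re ((b * (a^-1)%:C)^* * b) = nm b ^+ 2 / a.
  rewrite nm_sqr conjE; case: (b) => x y /=; ring.
rewrite nmM nmR gtr0_norm ?invr_gt0 //.
have -> : (nm b * a^-1) ^+ 2 * a = nm b ^+ 2 / a by field.
have : g <= nm b ^+ 2 / a by rewrite ler_pdivlMr.
by lra.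
Qed.

Let dist_kernel (t : C) i j : C := (1 - t * t^*) * kS i j +
  -1 * ((w i - t) * (w j - t)^* + ((w i - t) * z i) * ((w j - t) * z j)^*).

Let dist_psd t : (forall v, dform s al be ga t v <= 0) -> kpsd s (dist_kernel t).
Proof.
move=> tP v; have := tP v; rewrite -oppr_ge0 -ler0c; congr (_ <= _).
rewrite hformD !hformZ hformD hform_rank1 (hform_rank1 _ (fun i => (w i - t) * z i) (fun i => (w i - t) * z i)).
have -> : \sum_(i <- s) (v i)^* * (w i - t) = b1 v - t * a1 v.
  rewrite /b1 /a1 mulr_sumr -sumrB; apply: eq_bigr => i _; ring.
have -> : \sum_(i <- s) (v i)^* * ((w i - t) * z i) = b2 v - t * a2 v.
  rewrite /b2 /a2 mulr_sumr -sumrB; apply: eq_bigr => i _; ring.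
have [q0 _ _] := bounds (@form_ge0 v).
have gr : hform s ga v v = (qform s ga v)%:C.
  have /RRe_real <- // : hform s ga v v \is Num.real.
  by rewrite gaE realB ?ger0_real ?addr_ge0 ?exprn_ge0.
have -> : (- dform s al be ga t v)%:C = - (t * t^* * hform s al v v - (t^* * hform s be v v + (t^* * hform s be v v)^*) + hform s ga v v).
  rewrite (al_real al_psd) gr /dform -normCK normE -rmorphXn.
  move: (nm t ^+ 2) (t^* * hform s be v v) => n x.
  by rewrite conjE; apply/eqP; rewrite eq_complex; case: x => x y /=; apply/andP; split; apply/eqP; ring.
rewrite alE beE gaE !normCK !(rmorphM, rmorphB, rmorphD) /= !conjCK; ring.
Qed.

Let S_ge0 i : 0 <= S i i.
Proof.
rewrite /S -exprMn -normCK divr_ge0 ?exprn_ge0 //.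
by rewrite subr_ge0 expr_le1 // norm_le1 ltW.
Qed.

Let w_le1 i : i \in s -> `|w i| <= 1.
Proof.
move=> si; have e : `|1 : C| ^+ 2 + `|0 : C| ^+ 2 = 1 by rewrite normr1 normr0 expr1n expr0n addr0.
have := kpsd_diag s_uniq (hyp e) si.
rewrite /Kab mul0r addr0 conjC1 mulr1 -/(S i i) pmulr_lge0.
  by rewrite -normCK subr_ge0 expr_le1.
by rewrite (lt_le_trans ltr01) // lerDl.
Qed.

(** The last clause says [p / q = c + z^2 r / q], which makes the derivative at 0 vanish. Here [c]
    is the common point of the disks. *)
Lemma constrained_sufficient i0 : i0 \in s -> injective z ->
  exists p q r : {poly C}, exists c : C, [/\ rat_schur p q,
    forall i, i \in s -> p.[z i] = w i * q.[z i] & p = c%:P * q + 'X^2 * r].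
Proof.
move=> si0 z_inj.
have ali : 0 < al i0 i0.
  rewrite /al conjC1 mulr1 ltr_wpDl // ?ltr_pwDl ?ltr01 ?mul_conjC_ge0 //.
  by rewrite mulr_ge0 // -normCK subr_ge0 expr_le1 // w_le1.
have [v0 v0P] := kpsd_neq0_diag s_uniq si0 ali al_psd.
have [t tP] := disks_intersection al_psd pointwise v0P.
have D := dist_psd tP.
have Dii i : i \in s -> `|w i - t| ^+ 2 * (1 + `|z i| ^+ 2) <= (1 - `|t| ^+ 2) * kS i i.
  move=> si; rewrite -subr_ge0; have := kpsd_diag s_uniq D si; congr (_ <= _).
  by rewrite /dist_kernel !normCK rmorphM /=; ring.
have kSii i : i \in s -> 0 <= kS i i.
  by move=> si; rewrite mulr_ge0 // -normCK subr_ge0 expr_le1 // w_le1.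
have wt i : i \in s -> (1 - `|t| ^+ 2) * kS i i <= 0 -> w i = t.
  move=> si /(le_trans (Dii i si)); rewrite pmulr_lle0; last first.
    by rewrite ltr_pwDl ?ltr01 // exprn_ge0.
  move=> h; have : `|w i - t| ^+ 2 == 0 by rewrite eq_le h exprn_ge0.
  by rewrite expf_eq0 /= normr_eq0 subr_eq0 => /eqP.
(* For [|t| >= 1] the diagonal of [dist_kernel] forces all [w i] to equal [t], and a constant
   does. *)
have [t1|t1] := boolP (`|t| < 1); last first.
  have tge : 1 <= `|t| by rewrite real_leNgt ?num_real // ger0_real.
  have wc i : i \in s -> w i = t.
    move=> si; apply: wt => //; rewrite mulr_le0_ge0 ?kSii // subr_le0 exprn_ege1 //.
  exists t%:P, 1, 0, t; split=> [x _|i si|].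
  - rewrite !hornerE oner_neq0 normr1; split=> //.
    by rewrite -(wc i0 si0) w_le1.
  - by rewrite !hornerE wc.
  - by rewrite mulr1 mulr0 addr0.
pose W i := (w i - t) / (1 - t^* * w i).
have dw i : i \in s -> 1 - t^* * w i != 0.
  by move=> si; rewrite disk_sub_neq0 ?norm_conjC ?w_le1.
pose G i := W i / z i ^+ 2.
pose s' := [seq i <- s | z i != 0].
have dz i j : 1 - z i * (z j)^* != 0 by rewrite mulrC disk_sub_conj_neq0.
have Gp : kpsd s' (pick_kernel z G).
  have := kpsd_congr (fun i => (1 - t^* * w i)^-1 * (z i ^+ 2)^-1) (kpsd_filter (fun i => z i != 0) D).
  apply: eq_kpsd => i j; rewrite !mem_filter => /andP[zi si] /andP[zj sj].
  have zj' : (z j)^* != 0 by rewrite conjC_eq0.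
  have dwj : 1 - t * (w j)^* != 0.
    by have := dw j sj; rewrite -conjC_eq0 !(rmorphB, rmorphM) /= conjCK conjC1.
  rewrite /dist_kernel /kS /S /pick_kernel /G /W.
  rewrite !(fmorphV, rmorphM, rmorphB, rmorphXn) /= !conjCK !conjC1.
  by field; do ?[apply/andP; split] => //; [exact: dz | exact: dw].
have s'u : uniq (map z s') by rewrite map_inj_uniq ?filter_uniq.
have zD' i : `|z i| < 1 by rewrite norm_lt1.
have [p [q [pq e]]] := pick_rational zD' s'u Gp.
(* The Mobius map is undone: the fraction is [(z^2 G + t) / (1 + conj(t) z^2 G)] with
   [G = p / q]. *)
exists ('X^2 * p + t%:P * q), (q + (t^*)%:P * ('X^2 * p)), ((1 - t * t^*)%:P * p), t.
have h1 x : `|x| < 1 -> `|x ^+ 2 * p.[x]| < `|q.[x]|.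
  move=> /[dup] x1 /pq[q0 pq1]; rewrite normrM normrX.
  apply: le_lt_trans (_ : `|x| ^+ 2 * `|q.[x]| < _); first by rewrite ler_wpM2l // exprn_ge0.
  by rewrite gtr_pMl ?normr_gt0 // expr_lt1.
split=> [x x1|i si|].
- rewrite !(hornerXn, hornerD, hornerM, hornerC); set X := x ^+ 2 * _; have XY := h1 x x1; rewrite -/X in XY.
  split; last exact: mobius_norm (ltW t1) (ltW XY).
  rewrite addr_eq0; apply/eqP => e'; move: XY.
  rewrite e' normrN (normrM t^*) norm_conjC => h.
  have : `|t| * `|X| <= `|X| by rewrite ler_piMl // ltW.
  by move/(lt_le_trans h); rewrite ltxx.
(* A node at 0 was left out of [s']: there [kS] vanishes, so [w i = t], which is the value of the
   fraction at 0. *)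
- rewrite !(hornerXn, hornerD, hornerM, hornerC).
  have [zi|zi] := eqVneq (z i) 0.
    have -> : w i = t.
      by apply: wt => //; rewrite /kS /S zi expr0n mul0r mul0r mulr0 mulr0.
    by rewrite zi expr0n !mul0r mulr0 addr0 add0r.
  rewrite e ?mem_filter ?zi // /G /W; field; rewrite dw // zi //.
- by rewrite polyCB polyCM polyC1; ring.
Qed.

End Sufficiency.

(** * Matrices, norms and derivatives, and the final assembly *)

Section MatrixForm.
Variables (C : numClosedFieldType) (n : nat).

Lemma psdmxP (K : 'I_n -> 'I_n -> C) :
  psdmx (\matrix_(i, j) K i j) <-> kpsd (index_enum 'I_n) K.
Proof.
have E (v : 'cV[C]_n) : ((map_mx Num.conj v)^T *m (\matrix_(i, j) K i j) *m v) 0 0 =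
    hform (index_enum 'I_n) K (fun i => v i 0) (fun i => v i 0).
  rewrite mxE /hform exchange_big /=; apply: eq_bigr => j _.
  rewrite mxE mulr_suml; apply: eq_bigr => i _.
  by rewrite !mxE.
split=> [H v|H v]; last by rewrite E.
have := H (\col_i v i); rewrite E; congr (_ <= _).
by apply: eq_hform => // i _; rewrite mxE.
Qed.

End MatrixForm.

Lemma Hinfty_norm_le (R : realType) (f : Cplx R -> Cplx R) (A : R) :
  (Hinfty_norm f <= A%:E)%E <-> forall x, nm x < 1 -> nm (f x) <= A.
Proof.
split=> [H x x1|H].
  rewrite -lee_fin; apply: le_trans H; apply: ereal_sup_ubound.
  by exists x => //; rewrite /unit_disk /= norm_lt1.
apply: ge_ereal_sup => _ [x x1 <-]; rewrite lee_fin; apply: H.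
by rewrite -norm_lt1.
Qed.

Lemma peano_derive1 (R : realType) (f : Cplx R -> Cplx R) :
  peano f 0 -> bigO0 2 (fun h => f h - (f 0 + derive1 f 0 * h)).
Proof.
move=> /(_ 2%N)[p pf]; have lin := peano_linear pf.
have lin' : bigO0 2 (fun h => f h - (f 0 + p`_1 * h)).
  by apply: eq_bigO0 ltr01 _ lin => h _; rewrite add0r.
by rewrite (derive1_bigO0 lin').
Qed.

Theorem theorem1p1 (R : realType) (n : nat) (z w : 'I_n -> Cplx R) (A : R)
    (z_disk : forall i, z i \in unit_disk (Cplx R))
    (z_inj : injective z)
    (A_gt0 : 0 < A) :
  (exists f : Cplx R -> Cplx R,
     [/\ analytic_on (unit_disk (Cplx R)) f,
         (Hinfty_norm f <= A%:E)%E,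
         f^`() 0 = 0
       & forall i, f (z i) = w i])
  <->
  (forall alpha beta : Cplx R, `|alpha| ^+ 2 + `|beta| ^+ 2 = 1 ->
     psdmx (\matrix_(i, j) (((A%:C : Cplx R) ^+ 2 - w i * (w j)^*) *
                            Kab alpha beta (z i) (z j)))).
Proof.
pose C := Cplx R; pose a : C := A%:C.
have aP : 0 < a by rewrite /a (ltcR 0 A).
have a0 : a != 0 by rewrite gt_eqF.
have ar : a^* = a := conj_Creal (ger0_real (ltW aP)).
have na : nm a = A by rewrite nmR gtr0_norm.
have zD i : nm (z i) < 1 by have := z_disk i; rewrite inE /unit_disk /= norm_lt1.
(* Dividing the data by [A] multiplies the kernel by the positive constant [A^-2]. *)
pose u i : C := a^-1 * w i.
have scale alpha beta i j : (a ^+ 2 - w i * (w j)^*) * Kab alpha beta (z i) (z j) =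
    a ^+ 2 * ((1 - u i * (u j)^*) * Kab alpha beta (z i) (z j)).
  by rewrite /u rmorphM fmorphV /= ar; field.
have D0 : nm (0 : C) < 1 by rewrite nm0 ltr01.
split=> [[f [fan /Hinfty_norm_le fA f'0 fz]] alpha beta ab|H].
  have fp c : nm c < 1 -> peano f c.
    by move=> c1; apply: analytic_peano fan _; rewrite /unit_disk /= norm_lt1.
  pose g x := a^-1 * f x.
  have gp c : nm c < 1 -> peano g c by move=> c1; apply: peanoM (peano_cst _ _) (fp c c1).
  have g1 x : nm x < 1 -> nm (g x) <= 1.
    by move=> /fA; rewrite nmM nmV na ler_pdivrMl // mulr1.
  have g2 : bigO0 2 (fun h => g h - g 0).
    have := bigO0M (bigO0_cst a^-1) (peano_derive1 (fp 0 D0)).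
    by apply: eq_bigO0 ltr01 _ => h _; rewrite f'0 mul0r addr0 /g mulrBr.
  apply/psdmxP; have := constrained_necessary (index_enum 'I_n) zD gp g1 g2 ab.
  move/(@kpsdZ _ _ _ (a ^+ 2)); rewrite exprn_ge0 ?(ltW aP) // => /(_ isT).
  by apply: eq_kpsd => i j _ _; rewrite scale /g !fz.
(* Without nodes the zero function is a solution; otherwise a node is available for
   [constrained_sufficient]. *)
have [i0 _|noi] := pickP (@predT 'I_n); last first.
  exists (fun=> 0); split.
  - have := @analytic_rational R (unit_disk C) 0 1.
    have -> : (fun x : C => (0 : {poly C}).[x] / (1 : {poly C}).[x]) = fun=> 0.
      by apply/funext => x; rewrite horner0 mul0r.
    by apply=> c _; rewrite hornerC oner_neq0.
  - by apply/Hinfty_norm_le => x _; rewrite nm0 ltW.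
  - by apply: derive1_bigO0; exists 0, 1; split=> // h _; rewrite !mul0r addr0 subrr nm0.
  - by move=> i; have := noi i.
have hyp alpha beta : `|alpha| ^+ 2 + `|beta| ^+ 2 = 1 ->
    kpsd (index_enum 'I_n) (fun i j => (1 - u i * (u j)^*) * Kab alpha beta (z i) (z j)).
  move=> /H /psdmxP/(@kpsdZ _ _ _ (a ^+ 2)^-1); rewrite invr_ge0 exprn_ge0 ?(ltW aP) // => /(_ isT).
  apply: eq_kpsd => i j _ _; rewrite scale mulKf //; exact: expf_neq0.
have [p [q [r [c [pq pz pE]]]]] := constrained_sufficient (index_enum_uniq _) zD hyp
  (mem_index_enum i0) z_inj.
have q0 x : nm x < 1 -> q.[x] != 0 by rewrite -norm_lt1 => /pq[].
exists (fun x => (a%:P * p).[x] / q.[x]).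
have an : analytic_on (unit_disk C) (fun x => (a%:P * p).[x] / q.[x]).
  by apply: analytic_rational => x; rewrite /unit_disk /= norm_lt1 => /q0.
split=> //.
- apply/Hinfty_norm_le => x x1; rewrite hornerM hornerC -mulrA nmM na.
  have [qx pqx] := pq x ltac:(by rewrite norm_lt1).
  apply: ler_piMr; [exact: ltW | rewrite nmM]; rewrite nmV ler_pdivrMr ?mul1r; last first.
    by rewrite lt_def nm_eq0 qx nm_ge0.
  by rewrite -lecR.
- apply: derive1_bigO0.
  (* The solution differs from its value at 0 by [h^2] times this function, which is bounded near
     0. *)
  have an' : analytic_on (unit_disk C) (fun x => (a%:P * r).[x] / q.[x]).
    by apply: analytic_rational => x; rewrite /unit_disk /= norm_lt1 => /q0.
  have rp := analytic_peano an' (_ : unit_disk C 0).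
  rewrite /unit_disk /= norm_lt1 in rp.
  have := bigO0M (bigO0_Xn R 2) (peano_bounded (rp D0)).
  rewrite addn0; apply: eq_bigO0 ltr01 _ => h h1 /=.
  have qh := q0 h h1; have qz := q0 0 D0.
  rewrite add0r mul0r addr0 pE !(hornerXn, hornerM, hornerC, hornerD).
  by field; rewrite qh qz.
- move=> i; rewrite hornerM hornerC pz ?mem_index_enum // /u.
  by field; rewrite a0 q0.
Qed.
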